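(* For all positive integers $d,n$, the abacus hook monoid satisfies $$|\mathfrak{H}_{d,n}|=d^{n+1}\sum_{k=0}^{n}\Omega_k^{(n)}d^{-k}.$$
   Context: Let $\underline{\mathfrak{C}}_n$ be the partition monoid of $\{0,1,\dots,n\}\cup\{0',1',\dots,n'\}$ (product: stack the first partition above the second, identifying its primed points with the unprimed points of the second as a middle row, take connected components, and keep their nonempty intersections with the outer rows as blocks). Define $\underline{U}_0$ with blocks $\{0,1,0',1'\}$ and $\{k,k'\}$ ($2\le k\le n$), and for $1\le i\le n-1$, $\underline{U}_i$ with blocks $\{0,0'\},\{i,i+1\},\{i',(i+1)'\}$ and $\{k,k'\}$ ($k\in[1,n]\setminus\{i,i+1\}$). The hook blob monoid $\mathfrak{H}_n$ is the submonoid generated by $\underline{U}_0,\dots,\underline{U}_{n-1}$. The abacus hook monoid $\mathfrak{H}_{d,n}$ consists of pairs $(P,f)$ with $P\in\mathfrak{H}_n$ and $f$ a labelling of the blocks of $P$ by $\mathbb{Z}/d\mathbb{Z}$ (numbers of beads mod $d$). Product $(P,f)(Q,g)$: the underlying partition is $PQ$; each block of $PQ$ gets as label the sum of the labels of all blocks of $P$ and $Q$ contained in the connected component defining it; components lying entirely in the middle row (loops) are discarded together with their labels. Indexing matrices (for $n$): either the degenerate matrix $\left[\begin{smallmatrix}\infty\\ \infty\end{smallmatrix}\right]$, or a $2\times m$ matrix $A=[a_{ij}]$, $1\le m\le n$, with $a_{ij}\in[0,n-1]$, $a_{1j}<a_{1k}$ and $a_{2j}\le a_{2k}$ for $j<k$,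 $a_{2j}=a_{2k}$ with $j<k$ only if both are $0$, and $a_{1j}\ge a_{2j}$ for all $j$. The blob-rank is the number of columns containing a $0$ (degenerate: $0$); $\Omega_k^{(n)}$ is the number of indexing matrices for $n$ of blob-rank $k$. *)

(* Defs.v *)
From HB Require Import structures.
From mathcomp Require Import all_boot all_order all_algebra.

Set Implicit Arguments.
Unset Strict Implicit.
Unset Printing Implicit Defensive.

Import GRing.Theory.

(* (false, i) is the unprimed point i and (true, i) is the primed point i'. *)
Definition vertex (n : nat) : finType := (bool * 'I_n.+1)%type.

Definition diagram (n : nat) : finType :=
  {P : {set {set vertex n}} | partition P [set: vertex n]}.

Lemma partition_setT_intro (T : finType) (P : {set {set T}}) :
    set0 \notin P ->
    (forall x, exists2 B, B \in P & x \in B) ->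
    (forall B C x, B \in P -> C \in P -> x \in B -> x \in C -> B = C) ->
  partition P [set: T].
Proof.
move=> P0 Pcov Puniq; apply/and3P; split=> //.
  apply/eqP/setP=> x; rewrite inE; apply/bigcupP.
  by have [B PB xB] := Pcov x; exists B.
apply/trivIsetP=> B C PB PC; apply: contraNT=> /pred0Pn[x /andP[xB xC]].
by apply/eqP; apply: (Puniq B C x).
Qed.

(* Points of two stacked diagrams: rows Some false (top), None (middle) and
   Some true (bottom). *)
Definition stack_point (n : nat) : finType := (option bool * 'I_n.+1)%type.

Definition upper n (v : vertex n) : stack_point n :=
  (if v.1 then None else Some false, v.2).
Definition lower n (v : vertex n) : stack_point n :=
  (if v.1 then Some true else None, v.2).
Definition outer n (v : vertex n) : stack_point n := (Some v.1, v.2).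

Definition stack_rel n (P Q : diagram n) : rel (stack_point n) :=
  fun x y =>
    [exists B in val P, (x \in @upper n @: B) && (y \in @upper n @: B)]
    || [exists B in val Q, (x \in @lower n @: B) && (y \in @lower n @: B)].

Definition components n (P Q : diagram n) : {set {set stack_point n}} :=
  equivalence_partition (connect (stack_rel P Q)) [set: stack_point n].

Definition stack_blocks n (P Q : diagram n) : {set {set vertex n}} :=
  [set @outer n @^-1: C | C : {set stack_point n} in components P Q] :\ set0.

Lemma components_partition n (P Q : diagram n) :
  partition (components P Q) [set: stack_point n].
Proof.
have sym : symmetric (stack_rel P Q).
  move=> x y; congr (_ || _); apply: eq_existsb => B; congr (_ && _);
    exact: andbC.
apply: equivalence_partitionP => x y z _ _ _; split; first exact: connect0.
by move=> xy; apply: (same_connect (sym_connect_sym sym) xy).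
Qed.

Lemma stack_blocks_partition n (P Q : diagram n) :
  partition (stack_blocks P Q) [set: vertex n].
Proof.
have /and3P[/eqP cov triv _] := components_partition P Q.
apply: partition_setT_intro; first by rewrite !inE eqxx.
- move=> v; have: outer v \in cover (components P Q) by rewrite cov inE.
  case/bigcupP=> C PQC vC; exists (@outer n @^-1: C); last by rewrite inE.
  rewrite !inE imset_f // andbT; apply/set0Pn; exists v.
  by rewrite inE.
- move=> _ _ v /setD1P[_ /imsetP[C PQC ->]] /setD1P[_ /imsetP[D PQD ->]].
  rewrite !inE => vC vD; congr (_ @^-1: _).
  by rewrite -(def_pblock triv PQC vC) -(def_pblock triv PQD vD).
Qed.

Definition diagram_mul n (P Q : diagram n) : diagram n :=
  exist _ (stack_blocks P Q) (stack_blocks_partition P Q).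

Definition vertical n (k : 'I_n.+1) : {set vertex n} :=
  [set (false, k); (true, k)].

Definition one_blocks n : {set {set vertex n}} :=
  [set vertical k | k : 'I_n.+1].

Definition gen_blocks n (i : nat) : {set {set vertex n}} :=
  if i == 0 then
    [set v : vertex n | v.2 <= 1]
      |: [set vertical k | k : 'I_n.+1 & 2 <= k]
  else
    [set [set v : vertex n | v.2 == 0 :> nat];
         [set v : vertex n | ~~ v.1 &
            (v.2 == i :> nat) || (v.2 == i.+1 :> nat)];
         [set v : vertex n | v.1 &
            (v.2 == i :> nat) || (v.2 == i.+1 :> nat)]]
      :|: [set vertical k | k : 'I_n.+1 &
             [&& 1 <= k, k != i :> nat & k != i.+1 :> nat]].

Lemma in_vertical n (k : 'I_n.+1) (v : vertex n) :
  (v \in vertical k) = (v.2 == k).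
Proof. by case: v => [[] j]; rewrite !inE !xpair_eqE /= ?orbF. Qed.

Lemma one_blocks_partition n : partition (one_blocks n) [set: vertex n].
Proof.
rewrite /one_blocks; apply: partition_setT_intro.
- by apply/imsetP=> -[k _ /setP/(_ (false, k))]; rewrite in_vertical inE eqxx.
- by move=> v; exists (vertical v.2); rewrite ?in_vertical ?imset_f.
- move=> _ _ v /imsetP[k _ ->] /imsetP[l _ ->].
  by rewrite !in_vertical => /eqP<- /eqP<-.
Qed.

Lemma gen_blocks_partition n (i : 'I_n) :
  partition (gen_blocks n i) [set: vertex n].
Proof.
have i_n := ltn_ord i; rewrite /gen_blocks; case: ifPn => [_ | i0].
  apply: partition_setT_intro.
  - rewrite !inE negb_or; apply/andP; split.
      by apply/eqP=> /setP/(_ (false, ord0)); rewrite !inE.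
    apply/imsetP=> -[k _ /setP/(_ (false, k))].
    by rewrite in_vertical inE eqxx.
  - move=> v; have [v1 | v1] := leqP v.2 1.
      by exists [set w : vertex n | w.2 <= 1]; rewrite ?setU11 // inE.
    exists (vertical v.2); rewrite ?in_vertical //.
    by apply/setU1P; right; rewrite imset_f ?inE.
  - move=> B C v /setU1P[->|/imsetP[k + ->]] /setU1P[->|/imsetP[l + ->]] //;
      rewrite ?in_vertical !inE.
    + by move=> l2 vk /eqP vl; rewrite vl leqNgt l2 in vk.
    + by move=> k2 /eqP->; rewrite leqNgt k2.
    + by move=> _ _ /eqP<- /eqP<-.
apply: partition_setT_intro.
- rewrite !inE !negb_or -!andbA; apply/and4P; split.
  + by apply/eqP=> /setP/(_ (false, ord0)); rewrite !inE.
  + apply/eqP=> /setP/(_ (false, widen_ord (leqnSn n) i)).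
    by rewrite !inE /= eqxx.
  + apply/eqP=> /setP/(_ (true, widen_ord (leqnSn n) i)).
    by rewrite !inE /= eqxx.
  + apply/imsetP=> -[k _ /setP/(_ (false, k))].
    by rewrite in_vertical inE eqxx.
- move=> v; have [v0 | v0] := eqVneq (v.2 : nat) 0.
    exists [set w : vertex n | w.2 == 0 :> nat]; rewrite inE ?v0 //.
    by rewrite !inE eqxx.
  case vi: ((v.2 == i :> nat) || (v.2 == i.+1 :> nat)).
    case v1: v.1.
      exists [set w : vertex n | w.1 &
               (w.2 == i :> nat) || (w.2 == i.+1 :> nat)]; last by rewrite inE v1 vi.
      by rewrite !inE eqxx ?orbT.
    exists [set w : vertex n | ~~ w.1 &
               (w.2 == i :> nat) || (w.2 == i.+1 :> nat)]; last by rewrite inE v1 vi.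
    by rewrite !inE eqxx ?orbT.
  exists (vertical v.2); rewrite ?in_vertical //.
  by apply/setUP; right; rewrite imset_f // inE lt0n v0 -negb_or vi.
- move=> B C v.
  have iS (j : nat) : (j == i :> nat) || (j == i.+1) -> j != 0.
    by case/orP=> /eqP->.
  have kv (k : 'I_n.+1) : [&& 1 <= k, k != i :> nat & k != i.+1 :> nat] ->
      (k == 0 :> nat) = false /\ (k == i :> nat) || (k == i.+1 :> nat) = false.
    by case/and3P=> k0 /negbTE-> /negbTE->; rewrite eqn0Ngt k0.
  rewrite !inE -!orbA.
  case/or4P=> [/eqP->|/eqP->|/eqP->|/imsetP[k + ->]]
      /or4P[/eqP->|/eqP->|/eqP->|/imsetP[l + ->]] //;
    rewrite ?in_vertical !inE.
  all: try by move=> /eqP-> /andP[_ /iS].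
  all: try by move=> /andP[_ /iS/negbTE->].
  all: try by move=> /andP[/negbTE->].
  all: try by move=> /andP[->].
  all: try by move=> /kv[k0 k1] + /eqP vl; rewrite vl ?k0 ?k1 ?andbF.
  all: try by move=> /kv[k0 k1] /eqP->; rewrite ?k0 ?k1 ?andbF.
  by move=> _ _ /eqP<- /eqP<-.
Qed.

Definition diagram_one n : diagram n :=
  exist _ (one_blocks n) (one_blocks_partition n).

Definition gen n (i : 'I_n) : diagram n :=
  exist _ (gen_blocks n i) (gen_blocks_partition i).

Definition submonoid n (M : {set diagram n}) : bool :=
  (diagram_one n \in M) &&
  [forall P in M, forall Q in M, diagram_mul P Q \in M].

Definition hook_blob n : {set diagram n} :=
  \bigcap_(M : {set diagram n}
            | submonoid M && ([set gen i | i : 'I_n] \subset M)) M.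

Lemma hook_blob_one n : diagram_one n \in hook_blob n.
Proof. by apply/bigcapP=> M /andP[/andP[]]. Qed.

Lemma hook_blob_mul n (P Q : diagram n) :
  P \in hook_blob n -> Q \in hook_blob n -> diagram_mul P Q \in hook_blob n.
Proof.
move=> /bigcapP HP /bigcapP HQ; apply/bigcapP=> M HM.
have /andP[/andP[_ /forall_inP MM] _] := HM.
by have /forall_inP := MM _ (HP _ HM); apply; apply: HQ.
Qed.

(* Z/dZ for every d > 0, including the trivial group for d = 1, where 'Z_d
   would have two elements. *)
Definition beads (d : nat) : finZmodType := 'I_d.-1.+1.

Definition block n (P : diagram n) : finType :=
  {B : {set vertex n} | B \in val P}.

Definition labelling d n (P : diagram n) : finType :=
  {ffun block P -> beads d}.

Definition hook_diagram n : finType := {P : diagram n | P \in hook_blob n}.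

Definition abacus_hook (d n : nat) : finType :=
  {P : hook_diagram n & labelling d (val P)}.

(* Since D is nonempty, exactly one component C satisfies the condition of the
   outer sum; components inside the middle row never do, so the labels of
   loops are dropped. *)
Definition label_mul d n (P Q : diagram n)
    (f : labelling d P) (g : labelling d Q) : labelling d (diagram_mul P Q) :=
  [ffun D : block (diagram_mul P Q) =>
    \sum_(C in components P Q | @outer n @^-1: C == val D)
      (\sum_(B : block P | @upper n @: val B \subset C) f B
       + \sum_(B : block Q | @lower n @: val B \subset C) g B)]%R.

Definition abacus_one d n : abacus_hook d n :=
  existT (fun P : hook_diagram n => labelling d (val P))
    (exist _ (diagram_one n) (hook_blob_one n)) [ffun=> 0%R].

Definition abacus_mul d n (x y : abacus_hook d n) : abacus_hook d n :=
  existT (fun P : hook_diagram n => labelling d (val P))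
    (exist _ (diagram_mul (val (tag x)) (val (tag y)))
       (hook_blob_mul (valP (tag x)) (valP (tag y))))
    (label_mul (tagged x) (tagged y)).

(* Row ord0 is the first row (a_1j) and row ord_max the second row (a_2j). *)
Definition is_indexing n m (A : 'M['I_n]_(2, m)) : bool :=
  [&& [forall j : 'I_m, forall k : 'I_m, (j < k) ==> (A ord0 j < A ord0 k)],
      [forall j : 'I_m, forall k : 'I_m, (j < k) ==> (A ord_max j <= A ord_max k)],
      [forall j : 'I_m, forall k : 'I_m, (j < k) && (A ord_max j == A ord_max k) ==>
         (A ord_max j == 0 :> nat)]
    & [forall j : 'I_m, A ord_max j <= A ord0 j]].

(* None is the degenerate matrix; Some (existT m A) has m.+1 columns, so that
   the number of columns ranges over 1, ..., n. *)
Definition index_candidate n : finType :=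
  option {m : 'I_n & 'M['I_n]_(2, m.+1)}.

Definition indexing_matrix n (a : index_candidate n) : bool :=
  if a is Some A then is_indexing (tagged A) else true.

Definition blob_rank n (a : index_candidate n) : nat :=
  if a is Some A
  then #|[set j | [exists i, tagged A i j == 0 :> nat]]|
  else 0.

Definition Omega (n k : nat) : nat :=
  #|[set a : index_candidate n | indexing_matrix a & blob_rank a == k]|.

(* Main.v *)
(* Cut the circle of points 0, 1, ..., n, n', ..., 1', 0' at the special line
   0-0'. An element of the hook blob monoid is then a noncrossing matching of
   the 2n points 1, ..., n, n', ..., 1' in which some points, none of them under
   an arc, stay unmatched: these form the block of 0 and 0'. Writing an opening
   letter for left endpoints and unmatched points and a closing letter for right
   endpoints gives a bijection with ballot words of length 2n, under which the
   number of blocks is one more than the number of closing letters. Right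
   multiplication by a generator is a local move on these matchings, and every
   ballot word is reached from the identity by such moves.

   An indexing matrix is determined by the set of entries of its first row and
   the set of nonzero entries of its second row. Reading the membership bits of
   these two sets alternately, from the value n downwards, turns the inequality
   between the two rows into the ballot condition, and the blob-rank into n minus
   the number of closing letters. *)
Require Import Defs.
From mathcomp Require Import all_boot all_order all_algebra.
From mathcomp Require Import zify.

Set Implicit Arguments.
Unset Strict Implicit.
Unset Printing Implicit Defensive.

Import GRing.Theory Num.Theory.

(** * Noncrossing matchings and ballot words *)

(* Unmatched points are the fixed points of m; so are the positions from N on,
   which makes N a position for the special line. *)
Definition nc N (m : nat -> nat) : Prop :=
  [/\ forall p, N <= p -> m p = p, involutive m
    & forall p q, p < q < m p -> p < m q < m p /\ m q <> q].

Definition word N (m : nat -> nat) : seq bool := mkseq (fun p => p <= m p) N.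

Lemma nc_lt N m p : nc N m -> p < N -> m p < N.
Proof.
case=> mN mK _ pN; rewrite ltnNge; apply/negP => Nm.
by have := mN _ Nm; rewrite mK => e; lia.
Qed.

Lemma letter_eq N m1 m2 p : nc N m1 -> nc N m2 -> word N m1 = word N m2 ->
  (p <= m1 p) = (p <= m2 p).
Proof.
move=> [m1N _ _] [m2N _ _] e; have [pN|pN] := ltnP p N; last first.
  by rewrite m1N ?m2N.
by have := congr1 (nth true ^~ p) e; rewrite !nth_mkseq.
Qed.

(** Strong induction on closing positions [p]: if the two partners of [p] differ, the one nearer to
    [p] lies under the arc that the other matching has at [p]. It is an opening letter, so that
    matching closes it before [p], where both agree by induction; this contradicts involutivity.
    Opening positions follow through their partners. *)
Lemma nc_word_inj N m1 m2 : nc N m1 -> nc N m2 ->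
  word N m1 = word N m2 -> m1 =1 m2.
Proof.
move=> nc1 nc2 e.
have wE p := letter_eq p nc1 nc2 e.
have [_ m1K c1] := nc1; have [_ m2K c2] := nc2.
have closing p : m1 p < p -> m1 p = m2 p.
  elim/ltn_ind: p => p IH lt1; have := wE p => wEp.
  have [lt|lt|//] := ltngtP (m1 p) (m2 p).
  - have [|bd ne] := c1 (m1 p) (m2 p); first by rewrite m1K; lia.
    rewrite m1K in bd; have := wE (m2 p); rewrite m2K => o.
    have f : m1 (m1 (m2 p)) = m2 (m1 (m2 p)) by apply: IH; rewrite ?m1K; lia.
    by move: (congr1 m2 f); rewrite m1K !m2K; lia.
  - have [|bd ne] := c2 (m2 p) (m1 p); first by rewrite m2K; lia.
    rewrite m2K in bd; have := wE (m1 p); rewrite m1K => o.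
    have o2 := wE (m2 (m1 p)); rewrite m2K in o2.
    have f : m1 (m2 (m1 p)) = m2 (m2 (m1 p)) by apply: IH; lia.
    by move: (congr1 m1 f); rewrite m2K !m1K; lia.
move=> p; have := wE p => wEp.
have [lt|lt|lt] := ltngtP (m1 p) p; first exact: closing.
  have := closing (m1 p); rewrite m1K => /(_ lt) f.
  by rewrite f m2K -f.
have [//|lt2] : m2 p = p \/ p < m2 p by lia.
  by rewrite lt.
have := wE (m2 p); rewrite m2K => o.
have f : m1 (m2 p) = m2 (m2 p) by apply: closing; lia.
by move: (congr1 m1 f); rewrite m1K m2K; lia.
Qed.

Fixpoint ballot h (w : seq bool) : bool :=
  match w with
  | [::] => true
  | true :: w' => ballot h.+1 w'
  | false :: w' => (0 < h) && ballot h.-1 w'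
  end.

Lemma ballotP h w : reflect
  (forall p, count negb (take p w) <= h + count id (take p w)) (ballot h w).
Proof.
elim: w h => [|[] w IH] h /=; first by apply: ReflectT => p; rewrite /= addn0.
- apply: (iffP (IH _)) => H p.
  + by case: p => [|p] //=; have := H p; lia.
  + by have /= := H p.+1; lia.
- apply: (iffP andP) => [[h0 /IH H] [|p] //=|H].
  + by have := H p; lia.
  + have h0 : 0 < h by have /= := H 1; rewrite take0 /=; lia.
    split=> //; apply/IH => p; have /= := H p.+1; lia.
Qed.

Lemma ballot_cat h x y : ballot h (x ++ y) =
  ballot h x && ballot (h + count id x - count negb x) y.
Proof.
elim: x h => [|[] x IH] h /=; first by rewrite addn0 subn0.
- by rewrite IH; congr (_ && ballot _ _); lia.
- case: h => [|h] //=; rewrite IH; congr (_ && ballot _ _); lia.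
Qed.

Lemma leq_count_inj N M (a b : pred nat) (f : nat -> nat) :
  injective f -> (forall p, p < N -> a p -> f p < M /\ b (f p)) ->
  count a (iota 0 N) <= count b (iota 0 M).
Proof.
move=> f_inj H; rewrite -!size_filter -(size_map f); apply: uniq_leq_size.
  by rewrite map_inj_uniq // filter_uniq // iota_uniq.
move=> _ /mapP[p + ->]; rewrite !mem_filter !mem_iota !add0n /= => /andP[ap pN].
by have [-> ->] := H _ pN ap.
Qed.

(** In each prefix [m] sends closing positions injectively to opening positions of the same
    prefix. *)
Lemma word_ballot N m : nc N m -> ballot 0 (word N m).
Proof.
move=> ncm; have [_ mK _] := ncm.
apply/ballotP => p; rewrite -map_take take_iota !count_map add0n.
apply: (@leq_count_inj _ _ _ _ m); first exact: inv_inj.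
by move=> x /= xp; rewrite mK; lia.
Qed.

(** [m] sends opening positions injectively to closing ones. Used contrapositively: a surplus of
    opening letters forces an unmatched position. *)
Lemma word_nofix N m : nc N m -> (forall p, p < N -> m p <> p) ->
  count id (word N m) <= count negb (word N m).
Proof.
move=> ncm nofix; have [_ mK _] := ncm.
rewrite !count_map; apply: (@leq_count_inj _ _ _ _ m); first exact: inv_inj.
move=> x /= xp; rewrite mK; have := nofix _ xp; have := nc_lt ncm xp; lia.
Qed.

Lemma wordS N m : word N.+1 m = rcons (word N m) (N <= m N).
Proof. by rewrite /word /mkseq -addn1 iotaD map_cat cats1. Qed.

Lemma eq_word N m1 m2 :
  (forall p, p < N -> (p <= m1 p) = (p <= m2 p)) -> word N m1 = word N m2.
Proof.
by move=> e; apply/eq_in_map => p; rewrite mem_iota add0n /= => /e.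
Qed.

(** The matching is built from the left: a new opening letter stays unmatched, a new closing letter
    is joined to the last unmatched position. *)
Lemma ballot_word w : ballot 0 w ->
  exists2 m, nc (size w) m & word (size w) m = w.
Proof.
elim/last_ind: w => [_|w x IH]; first by exists id; [split=> // *; lia|].
rewrite -cats1 ballot_cat add0n => /andP[bw bx].
have [m ncm wm] := IH bw; have [mN mK mc] := ncm.
rewrite size_cat addn1 cats1; set N := size w in ncm wm mN *.
case: x bx => [_|/= /andP[lt _]].
  exists m; last by rewrite wordS wm mN // leqnn.
  by split=> // p ltp; apply: mN; lia.
have exf : exists p, (p < N) && (m p == p).
  have [ex|nex] := boolP (has (fun p => m p == p) (iota 0 N)).
    by have /hasP[p] := ex; rewrite mem_iota add0n /= => pN mp; exists p; apply/andP.
  have := word_nofix ncm; rewrite wm.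
  suff H : forall p, p < N -> m p <> p by move=> /(_ H); lia.
  move=> p pN mp; move/hasPn: nex => /(_ p); rewrite mem_iota add0n mp eqxx.
  by move=> /(_ pN).
(* Taking the last unmatched position leaves none under the new arc; no old arc crosses it, since
   [f] was under no arc. *)
have [f /andP[fN /eqP mf] fmax] :=
  ex_maxnP exf (fun p H => ltnW (proj1 (andP H))).
have fixle p : p < N -> m p = p -> p <= f.
  by move=> pN mp; apply: fmax; rewrite pN mp eqxx.
have m_lt p : p < N -> m p < N := @nc_lt N m p ncm.
exists (fun p => if p == f then N else if p == N then f else m p).
- split.
  + by move=> p pN; rewrite !ifN; try lia; apply: mN; lia.
  + move=> p; have [->|pf] := eqVneq p f; first by rewrite eqxx ifN //; lia.
    have [->|pN] := eqVneq p N; first by rewrite eqxx.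
    have [e|_] := eqVneq (m p) f.
      by move: (mK p); rewrite e mf; lia.
    have [e|_] := eqVneq (m p) N; last exact: mK.
    by move: (mK p); rewrite e mN //; lia.
  + move=> p q; have [->|pf] := eqVneq p f.
      case/andP=> fq qN; rewrite !ifN; try lia.
      have nq : m q <> q by move=> e; have := fixle _ qN e; lia.
      have mq := m_lt _ qN; split=> //; apply/andP; split=> //.
      rewrite ltnNge; apply/negP => le.
      have ne : m q <> f by move=> e; move: (mK q); rewrite e mf; lia.
      have [|_] := mc (m q) f; first by rewrite mK; lia.
      by rewrite mf.
    have [->|pN] := eqVneq p N; first by lia.
    move=> pq; have [_ ne] := mc _ _ pq.
    have qf : q <> f by move=> e; rewrite e mf in ne.
    have qN : q <> N.
      have [/m_lt|/mN] := ltnP p N; lia.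
    by rewrite !ifN; try lia; apply: mc.
- rewrite wordS eqxx ifN; last by lia.
  have -> : (N <= f) = false by lia.
  congr rcons; rewrite -wm; apply: eq_word => p pN.
  have [->|pf] := eqVneq p f; first by rewrite mf; lia.
  by rewrite ifN //; lia.
Qed.

(** * Local moves on matchings *)

Definition linked (m : nat -> nat) (p q : nat) : bool :=
  [|| p == q, m p == q | (m p == p) && (m q == q)].

(** Colours blocks by left endpoints, so that membership in a common block becomes equality of
    colours; [None] is the colour of the block of 0 and 0'. *)
Definition link_class (m : nat -> nat) (p : nat) : option nat :=
  if m p == p then None else Some (minn p (m p)).

Lemma link_classP m p q : involutive m ->
  (link_class m p == link_class m q) = linked m p q.
Proof.
move=> mK; rewrite /linked /link_class; have := mK p; have := mK q.
have [->|/eqP pq] := eqVneq p q; first by rewrite eqxx.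
have [ep|np] := eqVneq (m p) p; have [eq|nq] := eqVneq (m q) q;
  rewrite ?andbF ?orbF //.
- by rewrite orbT.
- by move=> _ _; case: (eqVneq (m p) q) => [e|//]; lia.
- by move=> f g; case: (eqVneq (m p) q) => [e|//]; rewrite e in g; lia.
move=> fq fp; apply/eqP/eqP => [[]|e]; last by rewrite -e fp minnC.
move=> e; have i := @inv_inj _ m mK p q; have [] : p = m q \/ m p = q by lia.
  by move=> ->; rewrite fq.
by [].
Qed.

(* The effect of multiplying on the right by the generator whose hook sits at
   the positions a and a+1: these get linked to each other and so do their
   former partners. *)
Definition hook_act a (m : nat -> nat) (p : nat) : nat :=
  if p == a then a.+1 else if p == a.+1 then a
  else if m p == a then (if m a.+1 == a.+1 then p else m a.+1)
  else if m p == a.+1 then (if m a == a then p else m a)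
  else m p.

(** Right multiplication by the generator of index 0 joins 1', at position [a], to the block of 0,
    so [a] and its partner become unmatched. *)
Definition blob_act a (m : nat -> nat) (p : nat) : nat :=
  if (p == a) || (m p == a) then p else m p.

(** An arc above the freed partner of [N] would have to enclose [N], which is the last position. *)
Lemma blob_act_nc N m : nc N.+1 m -> nc N.+1 (blob_act N m).
Proof.
move=> ncm; have [mN mK mc] := ncm; split.
- by move=> p pN; rewrite /blob_act; case: ifP => // _; apply: mN.
- move=> p; rewrite /blob_act; case: (boolP ((p == N) || _)) => [->//|].
  rewrite negb_or mK => /andP[pN mpN].
  by rewrite (negbTE mpN) (negbTE pN).
- move=> p q; rewrite /blob_act; case: ifP => [|pN pq]; first by lia.
  have [mq nq] := mc _ _ pq; have mp : m p < N.+1 by have := mN (m p); rewrite mK; lia.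
  by rewrite ifN //; lia.
Qed.

Lemma hook_actE a m p : involutive m -> hook_act a m p =
  if p == a then a.+1 else if p == a.+1 then a
  else if p == m a then (if m a.+1 == a.+1 then p else m a.+1)
  else if p == m a.+1 then (if m a == a then p else m a)
  else m p.
Proof.
move=> mK; rewrite /hook_act.
by rewrite (can2_eq mK mK) (can2_eq mK mK p a.+1).
Qed.

Lemma hook_act_id a m : involutive m -> m a = a.+1 -> hook_act a m =1 m.
Proof.
move=> mK e p; have e' : m a.+1 = a by rewrite -e mK.
rewrite hook_actE // e e'.
by case: (eqVneq p a) => [->//|_]; case: (eqVneq p a.+1) => [->//|].
Qed.

Lemma hook_actl a m : hook_act a m a = a.+1.
Proof. by rewrite /hook_act eqxx. Qed.

Lemma hook_actr a m : hook_act a m a.+1 = a.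
Proof. by rewrite /hook_act eqxx ifN //; lia. Qed.

Lemma hook_act_partl a m : involutive m -> m a <> a.+1 -> m a <> a ->
  hook_act a m (m a) = if m a.+1 == a.+1 then m a else m a.+1.
Proof.
by move=> mK na ne; rewrite hook_actE //; do ![case: eqVneq => //= ?]; lia.
Qed.

Lemma hook_act_partr a m : involutive m -> m a <> a.+1 -> m a.+1 <> a.+1 ->
  hook_act a m (m a.+1) = if m a == a then m a.+1 else m a.
Proof.
move=> mK na ne; have na' : m a.+1 <> a.
  by move=> e; apply: na; have := mK a.+1; rewrite e.
have ab : m a <> m a.+1 by move=> e; have := congr1 m e; rewrite !mK; lia.
by rewrite hook_actE //; do ![case: eqVneq => //= ?]; lia.
Qed.

Lemma hook_act_other a m p : involutive m ->
  p <> a -> p <> a.+1 -> p <> m a -> p <> m a.+1 -> hook_act a m p = m p.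
Proof. by move=> *; rewrite hook_actE //; do ![case: eqVneq => //= ?]; lia. Qed.

Lemma eq_nc N m1 m2 : m1 =1 m2 -> nc N m1 -> nc N m2.
Proof.
move=> e [mN mK mc]; split.
- by move=> p; rewrite -e; apply: mN.
- by move=> p; rewrite -!e; apply: mK.
- by move=> p q; rewrite -!e; apply: mc.
Qed.

(** Any other arc covers both or neither of the adjacent positions [a] and [a.+1], hence both or
    neither of their partners, so it does not cross the new arc. If one of the two positions is
    unmatched, no arc covers them, and the partner of the other may be freed. *)
Lemma hook_act_nc N a m : a.+1 < N -> nc N m -> nc N (hook_act a m).
Proof.
move=> aN ncm; have [mN mK mc] := ncm.
have [e|/eqP na] := eqVneq (m a) a.+1.
  by apply: eq_nc ncm => p; rewrite hook_act_id.
have na' : m a.+1 <> a by move=> e; apply: na; have := mK a.+1; rewrite e.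
have ma : m a < N by apply: nc_lt ncm _; lia.
have mb : m a.+1 < N by apply: nc_lt ncm _; lia.
have ab : m a <> m a.+1 by move=> e; have := congr1 m e; rewrite !mK; lia.
have mEa x : m x = a -> x = m a by move=> <-; rewrite mK.
have mEb x : m x = a.+1 -> x = m a.+1 by move=> <-; rewrite mK.
have mI x y : m x = m y -> x = y by apply: inv_inj.
split.
- by move=> p pN; rewrite hook_actE // (mN _ pN) !ifN //; lia.
- have ha := hook_actl a m; have hb := hook_actr a m.
  have hma := hook_act_partl mK na; have hmb := hook_act_partr mK na.
  have hg p : p <> a -> p <> a.+1 -> p <> m a -> p <> m a.+1 ->
      hook_act a m p = m p := @hook_act_other a m p mK.
  move=> p.
  case: (eqVneq p a) => [->|/eqP pa]; first by rewrite ha.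
  case: (eqVneq p a.+1) => [->|/eqP pb]; first by rewrite hb.
  case: (eqVneq p (m a)) => [e|/eqP pma].
    subst p; rewrite hma //; case: eqVneq => [e|/eqP ne]; rewrite ?hma ?e ?eqxx //.
    by rewrite hmb // ifN //; lia.
  case: (eqVneq p (m a.+1)) => [e|/eqP pmb].
    subst p; rewrite hmb //; case: eqVneq => [e|/eqP ne]; rewrite ?hmb ?e ?eqxx //.
    by rewrite hma // ifN //; lia.
  have := mEa p; have := mEb p; have := mI p a; have := mI p a.+1.
  by move=> *; rewrite (hg p) // hg //; lia.
- move=> p z; rewrite !hook_actE //.
  case: (eqVneq p a) => [->|/eqP pa]; first by lia.
  case: (eqVneq p a.+1) => [->|/eqP pb]; first by lia.
  (* These instances leave the two old arcs nested or side by side. *)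
  have c1 := mc a a.+1; have c2 := mc (m a) (m a.+1).
  have c3 := mc (m a.+1) (m a); have c4 := mc (m a.+1) a.
  rewrite !mK in c2 c3 c4.
  case: (eqVneq p (m a)) => [e|/eqP pma].
    subst p; case: (eqVneq (m a.+1) a.+1) => [_|/eqP ne]; first by lia.
    move=> zz; have lt : m a < a /\ a.+1 < m a.+1 by lia.
    have d1 := mc (m a) z; have d2 := mc a.+1 z; rewrite mK in d1.
    by do ![case: eqVneq => //= ?]; lia.
  case: (eqVneq p (m a.+1)) => [e|/eqP pmb].
    subst p; case: (eqVneq (m a) a) => [_|/eqP ne]; first by lia.
    move=> zz; have := mI z a; have := mI z a.+1 => i1 i2.
    have := mEa z; have := mEb z => i3 i4.
    have [lt|lt] := ltnP (m a.+1) a.+1.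
      have d1 := mc (m a.+1) z; have d2 := mc z (m a).
      by rewrite !mK in d1 d2; do ![case: eqVneq => //= ?]; lia.
    have d1 := mc a z; have d2 := mc (m z) (m a.+1).
    by rewrite !mK in d2; do ![case: eqVneq => //= ?]; lia.
  move=> zz; have := mI p a; have := mI p a.+1 => i1 i2.
  have := mEa p; have := mEb p => i3 i4.
  have d1 := mc p a; have d2 := mc p a.+1; have d3 := mc p _ zz.
  have d4 := mc p (m a); have d5 := mc p (m a.+1).
  rewrite !mK in d4 d5.
  by do ![case: eqVneq => //= ?]; subst; lia.
Qed.

(** The connecting half: a colouring that respects the old blocks and the hook respects the new
    blocks. The positions [a] and [a.+1] are excluded because after the move they name bottom
    points, while [f] colours the middle row there. *)
Lemma hook_act_sound (T : Type) a m (f : nat -> T) : involutive m ->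
  (forall p q, linked m p q -> f p = f q) -> f a = f a.+1 ->
  forall p q, p \notin [:: a; a.+1] -> q \notin [:: a; a.+1] ->
  linked (hook_act a m) p q -> f p = f q.
Proof.
move=> mK fm fa.
have [e|/eqP na] := eqVneq (m a) a.+1.
  move=> p q _ _; rewrite /linked !hook_act_id //; exact: fm.
have na' : m a.+1 <> a by move=> e; apply: na; have := mK a.+1; rewrite e.
have fl p : f (m p) = f p by apply: fm; rewrite /linked mK eqxx orbT.
have ff p q : m p = p -> m q = q -> f p = f q.
  by move=> ep eq; apply: fm; rewrite /linked ep eq !eqxx !orbT.
have fact p : p \notin [:: a; a.+1] -> f (hook_act a m p) = f p.
  rewrite !inE negb_or => /andP[/negbTE pa /negbTE pb]; rewrite hook_actE // pa pb.
  case: eqVneq => [->|_]; first by case: eqVneq; rewrite // !fl.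
  by case: eqVneq => [->|_]; [case: eqVneq; rewrite // !fl|rewrite fl].
(* A partner of [a] or [a.+1] is freed only when the other of these two positions was unmatched, so
   it has the colour of an old unmatched position. *)
have ffix p : p \notin [:: a; a.+1] -> hook_act a m p = p ->
    exists2 r, m r = r & f p = f r.
  rewrite !inE negb_or => /andP[/negbTE pa /negbTE pb]; rewrite hook_actE // pa pb.
  case: eqVneq => [->|_].
    case: eqVneq => [e _|_ e]; first by exists a.+1; rewrite // fl.
    by have := inv_inj mK e; lia.
  case: eqVneq => [->|_]; last by move=> e; exists p.
  case: eqVneq => [e _|_ e]; first by exists a; rewrite // fl.
  by have := inv_inj mK e; lia.
move=> p q pa qa /or3P[/eqP->//|/eqP<-|/andP[/eqP ep /eqP eq]].
  by rewrite fact.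
have [r er ->] := ffix _ pa ep; have [s es ->] := ffix _ qa eq; exact: ff.
Qed.

(** The separating half: the colouring by new blocks extends to the two hooked middle points, with
    one common colour [c], and stays constant on old blocks. *)
Lemma hook_act_complete N a m : a.+1 < N -> nc N m -> exists c,
  forall p q, linked m p q ->
    (if p \in [:: a; a.+1] then c else link_class (hook_act a m) p) =
    (if q \in [:: a; a.+1] then c else link_class (hook_act a m) q).
Proof.
move=> aN ncm; have [_ mK _] := ncm.
have [_ hK _] := hook_act_nc aN ncm.
have [e|/eqP na] := eqVneq (m a) a.+1.
  have e' : m a.+1 = a by rewrite -e mK.
  (* The two middle points form a loop and any colour would do; this one makes the whole colouring
     equal to [link_class m]. *)
  exists (Some a) => p q.
  have hE x : link_class (hook_act a m) x = link_class m x.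
    by rewrite /link_class hook_act_id.
  have h x : (if x \in [:: a; a.+1] then Some a else link_class m x) = link_class m x.
    rewrite !inE; case: eqVneq => [->|_] /=.
      by rewrite /link_class e ifN; [congr Some|]; lia.
    by case: eqVneq => [->|_] //=; rewrite /link_class e' ifN; [congr Some|]; lia.
  by rewrite !hE !h => l; apply/eqP; rewrite link_classP.
have na' : m a.+1 <> a by move=> e; apply: na; have := mK a.+1; rewrite e.
have hpl := hook_act_partl mK na; have hpr := hook_act_partr mK na.
have hg p := @hook_act_other a m p mK.
have lh p : link_class (hook_act a m) (hook_act a m p) =
    link_class (hook_act a m) p.
  by apply/eqP; rewrite link_classP // /linked hK eqxx orbT.
(* The middle points inherit the colour of the partner of [a], or that of the special block when [a]
   is unmatched. *)
pose c := if m a == a then None else link_class (hook_act a m) (m a).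
exists c; pose F p := if p \in [:: a; a.+1] then c else link_class (hook_act a m) p.
have Fm p : p \in [:: a; a.+1] -> F (m p) = F p.
  move=> pa; rewrite /F pa; move: pa; rewrite !inE => /orP[]/eqP->.
    rewrite /c; case: (eqVneq (m a) a) => [_|ne]; first by [].
    by case: (eqVneq (m a) a.+1) => [|_].
  case: (eqVneq (m a.+1) a.+1) => [_|/eqP ne]; first by rewrite orbT.
  case: (eqVneq (m a.+1) a) => [|_] //=.
  rewrite /c; case: (eqVneq (m a) a) => [e|/eqP ne2].
    by rewrite /link_class hpr // e !eqxx.
  by rewrite -(lh (m a)) hpl // ifN //; apply/eqP.
have FmE p : F (m p) = F p.
  have [pa|pa] := boolP (p \in [:: a; a.+1]); first exact: Fm.
  have [mpa|mpa] := boolP (m p \in [:: a; a.+1]); first by rewrite -Fm // mK.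
  rewrite /F (negbTE pa) (negbTE mpa).
  have e : hook_act a m p = m p.
    by apply: hg => e; move: mpa pa; rewrite e ?mK !inE eqxx ?orbT.
  by rewrite -e lh.
have Ffix p : m p = p -> F p = None.
  move=> mp; rewrite /F !inE; case: eqVneq => [e|pa] /=.
    by rewrite /c -e mp eqxx.
  case: eqVneq => [e|pb] /=.
    rewrite /c; case: (eqVneq (m a) a) => [//|/eqP ne].
    by rewrite /link_class hpl // -e mp !eqxx.
  have e : hook_act a m p = m p.
    by apply: hg; move=> e; move: mp pa pb; rewrite e ?mK; lia.
  by rewrite /link_class e mp eqxx.
move=> p q; rewrite -/(F p) -/(F q).
by case/or3P => [/eqP->//|/eqP<-|/andP[/eqP /Ffix-> /eqP /Ffix->]].
Qed.

(* Here N is the position of 1' and N.+1 that of the special line. *)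
Lemma blob_act_sound (T : Type) N m (f : nat -> T) : nc N.+1 m ->
  (forall p q, linked m p q -> f p = f q) -> f N = f N.+1 ->
  forall p q, linked (blob_act N m) p q -> f p = f q.
Proof.
move=> [mN mK _] fm fa.
have fl p : f (m p) = f p by apply: fm; rewrite /linked mK eqxx orbT.
have ff p : m p = p -> f p = f N.
  by move=> ep; rewrite fa; apply: fm; rewrite /linked ep mN // !eqxx !orbT.
have fact p : f (blob_act N m p) = f p by rewrite /blob_act; case: ifP.
have ffix p : blob_act N m p = p -> f p = f N.
  rewrite /blob_act; case: ifP => [/orP[/eqP->//|/eqP e] _|_]; last exact: ff.
  by rewrite -fl e.
move=> p q /or3P[/eqP->//|/eqP<-|/andP[/eqP /ffix-> /eqP /ffix->]//].
by rewrite fact.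
Qed.

(** Dropping an arc into the special block only merges blocks. *)
Lemma blob_act_complete N m p q : nc N.+1 m -> linked m p q ->
  linked (blob_act N m) p q.
Proof.
move=> [mN mK _]; rewrite /linked /blob_act.
have [->|pq] := eqVneq p q; rewrite //=.
case/orP=> [/eqP mp|/andP[/eqP-> /eqP->]].
  subst q; rewrite mK; case: (eqVneq p N) => [->|_].
    by rewrite orbT !eqxx orbT.
  by case: (eqVneq (m p) N) => _; rewrite /= !eqxx ?orbT.
by rewrite !orbb !if_same !eqxx orbT.
Qed.

Lemma blob_act_link N m : nc N.+1 m -> linked (blob_act N m) N N.+1.
Proof.
move=> [mN mK _]; rewrite /linked /blob_act (mN N.+1) //.
by rewrite if_same /= !eqxx !orbT.
Qed.

(** Away from the hook a letter changes only if a partner moves to the other side. This happens at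
    [m a] when the arc at [a.+1] encloses the arc at [a]: then [m a] becomes the right end of the
    arc from [m a.+1]. *)
Lemma hook_act_letters a m p : involutive m ->
  m a < a -> (a < m a.+1 \/ m a.+1 < m a) -> p != a -> p != a.+1 ->
  (p <= hook_act a m p) = 
  if (m a.+1 < m a) && (p == m a) then false else p <= m p.
Proof.
move=> mK lt H /eqP pa /eqP pb; have na : m a <> a.+1 by lia.
case: (eqVneq p (m a)) => [->|/eqP pma].
  rewrite hook_act_partl ?mK ?eqxx ?andbT //; last by lia.
  by case: (eqVneq (m a.+1)) => [e|/eqP ne]; case: ltnP; lia.
rewrite andbF; case: (eqVneq p (m a.+1)) => [e|/eqP pmb].
  by subst p; rewrite hook_act_partr // ifN ?mK; lia.
by rewrite hook_act_other.
Qed.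

(** By induction the inner positions around the centre [c] are matched symmetrically. A partner of
    [c + t] further left would trap the opening position [c - t.+1] with no free closing position
    under the arc. *)
Lemma nested_partner N m c t : nc N m ->
  (forall j, j <= t -> c - j.+1 <= m (c - j.+1) /\ m (c + j) < c + j) ->
  t < c -> m (c + t) = c - t.+1.
Proof.
move=> [mN mK mc]; elim/ltn_ind: t => t IH H tc.
have [h1 h2] := H t (leqnn t).
have IH' j : j < t -> m (c + j) = c - j.+1.
  by move=> jt; apply: IH => //; [move=> i ij; apply: H|]; lia.
have IH2 j : j < t -> m (c - j.+1) = c + j by move=> jt; rewrite -IH' // mK.
have [lt|lt|//] := ltngtP (m (c + t)) (c - t.+1).
  have [|bd ne] := mc (m (c + t)) (c - t.+1); first by rewrite mK; lia.
  rewrite mK in bd.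
  have h := IH' (m (c - t.+1) - c); have h' := IH2 (c - (m (c - t.+1)).+1).
  have i := @inv_inj _ m mK.
  have [le|gt] := leqP c (m (c - t.+1)).
    by move: h; rewrite subnKC // mK; lia.
  have e : c - (c - (m (c - t.+1)).+1).+1 = m (c - t.+1) by lia.
  by move: h'; rewrite e mK; lia.
have [le|gt] := leqP c (m (c + t)).
  have := IH' (m (c + t) - c); rewrite subnKC // mK; lia.
have e : c - (c - (m (c + t)).+1).+1 = m (c + t) by lia.
by have := IH2 (c - (m (c + t)).+1); rewrite e mK; lia.
Qed.

(** * Products of partition diagrams *)

Definition same n (P : diagram n) (v w : vertex n) : bool :=
  w \in pblock (val P) v.

Lemma same_mem n (P : diagram n) v w (B : {set vertex n}) :
  B \in val P -> v \in B -> same P v w = (w \in B).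
Proof.
move=> PB vB; have /and3P[_ triv _] := valP P.
by rewrite /same (def_pblock triv PB vB).
Qed.

Lemma sameP n (P : diagram n) v w :
  reflect (exists2 B, B \in val P & (v \in B) && (w \in B)) (same P v w).
Proof.
have /and3P[/eqP cov triv _] := valP P.
apply: (iffP idP) => [vw|[B PB /andP[vB wB]]].
  exists (pblock (val P) v); first by rewrite pblock_mem // cov inE.
  by rewrite mem_pblock cov inE.
by rewrite (same_mem _ PB vB).
Qed.

Lemma eq_diagram n (P Q : diagram n) : same P =2 same Q -> P = Q.
Proof.
suff H (P' Q' : diagram n) : same P' =2 same Q' -> {subset val P' <= val Q'}.
  move=> e; apply/val_inj/setP => B.
  apply/idP/idP; apply: H => // v w; exact/esym.
move=> e B PB.
have /and3P[_ triv n0] := valP P'.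
have /and3P[/eqP cov triv' _] := valP Q'.
have [v vB] : exists v, v \in B.
  by apply/set0Pn; apply: contraNneq n0 => <-.
suff -> : B = pblock (val Q') v by rewrite pblock_mem // cov inE.
by apply/setP => w; rewrite -(same_mem _ PB vB) e.
Qed.

Lemma stack_relP n (P Q : diagram n) x y : reflect
  ((exists v w, [/\ x = upper v, y = upper w & same P v w]) \/
   (exists v w, [/\ x = lower v, y = lower w & same Q v w]))
  (stack_rel P Q x y).
Proof.
apply: (iffP orP) => -[].
- case/exists_inP => B PB /andP[/imsetP[v vB ->] /imsetP[w wB ->]].
  by left; exists v, w; split=> //; apply/sameP; exists B; rewrite // vB.
- case/exists_inP => B PB /andP[/imsetP[v vB ->] /imsetP[w wB ->]].
  by right; exists v, w; split=> //; apply/sameP; exists B; rewrite // vB.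
- move=> [v [w [-> -> /sameP[B PB /andP[vB wB]]]]].
  by left; apply/exists_inP; exists B; rewrite // !imset_f.
- move=> [v [w [-> -> /sameP[B PB /andP[vB wB]]]]].
  by right; apply/exists_inP; exists B; rewrite // !imset_f.
Qed.

Lemma stack_rel_sym n (P Q : diagram n) : connect_sym (stack_rel P Q).
Proof.
apply: sym_connect_sym => x y; congr (_ || _); apply: eq_existsb => B;
  congr (_ && _); exact: andbC.
Qed.

Lemma same_mul n (P Q : diagram n) v w :
  same (diagram_mul P Q) v w = connect (stack_rel P Q) (outer v) (outer w).
Proof.
have /and3P[/eqP cov triv _] := components_partition P Q.
set C := pblock (components P Q) (outer v).
have vC : outer v \in C by rewrite mem_pblock cov inE.
have CPQ : C \in components P Q by rewrite pblock_mem // cov inE.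
have BPQ : @outer n @^-1: C \in val (diagram_mul P Q).
  rewrite /= !inE imset_f // andbT; apply/set0Pn; exists v.
  by rewrite inE.
rewrite (same_mem _ BPQ) ?inE // /C /components pblock_equivalence_partition //.
move=> x y z _ _ _; split; first exact: connect0.
by move=> xy; apply: (same_connect (stack_rel_sym _ _) xy).
Qed.

Definition stack_invariant n (P Q : diagram n) (T : Type)
    (f : stack_point n -> T) :=
  (forall v w, same P v w -> f (upper v) = f (upper w)) /\
  (forall v w, same Q v w -> f (lower v) = f (lower w)).

Lemma connect_invariant n (P Q : diagram n) T (f : stack_point n -> T) x y :
  stack_invariant P Q f -> connect (stack_rel P Q) x y -> f x = f y.
Proof.
move=> [fP fQ] /connectP[s xs ->]; elim: s x xs => //= z s IH x /andP[xz /IH<-].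
by case/stack_relP: xz => -[v [w [-> -> vw]]]; [apply: fP|apply: fQ].
Qed.

(** Two-valued colourings replace paths: the indicator of a component is an invariant colouring that
    separates it from all other points. *)
Lemma same_mulP n (P Q : diagram n) v w : reflect
  (forall f : stack_point n -> bool, stack_invariant P Q f ->
    f (outer v) = f (outer w))
  (same (diagram_mul P Q) v w).
Proof.
rewrite same_mul; apply: (iffP idP) => [vw f fPQ|H].
  exact: connect_invariant vw.
rewrite -(H (connect (stack_rel P Q) (outer v))) ?connect0 //.
have sym := stack_rel_sym P Q.
split=> [x y xy|x y xy]; apply: same_connect_r => //; apply: connect1;
  apply/stack_relP; [left|right]; by exists x, y.
Qed.

(** * Associativity of the diagram product *)

Section Assoc.
Variables (n : nat) (P Q R : diagram n).

(** Extends a colouring of the outer rows to the middle row: a component is true when it meets a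
    true outer point, so loops are false. *)
Let reach (S T : diagram n) (g : vertex n -> bool) (z : stack_point n) :=
  [exists u : vertex n, connect (stack_rel S T) z (outer u) && g u].

Let reach_invariant S T g : stack_invariant S T (reach S T g).
Proof.
have sym := stack_rel_sym S T.
split=> v w vw; apply: eq_existsb => u; congr (_ && _);
  apply: same_connect => //; apply: connect1; apply/stack_relP;
  [left|right]; by exists v, w.
Qed.

Let reach_outer S T g u :
  (forall v w, same (diagram_mul S T) v w -> g v = g w) ->
  reach S T g (outer u) = g u.
Proof.
move=> gST; apply/existsP/idP => [[w /andP[uw gw]]|gu].
  by rewrite (gST u w) // same_mul.
by exists u; rewrite connect0.
Qed.

(** [reach] colours the hidden row between [P] and [Q]; together with [f] this colours the
    three-layer stack, from which colourings of [P] over [QR] and of [Q] over [R] are cut out. *)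
Lemma same_mulA1 v w : same (diagram_mul P (diagram_mul Q R)) v w ->
  same (diagram_mul (diagram_mul P Q) R) v w.
Proof.
move=> /same_mulP H; apply/same_mulP => f [fPQ fR].
pose L := reach P Q (fun u => f (upper u)).
have Lo u : L (outer u) = f (upper u) by apply: reach_outer.
have [LP LQ] : stack_invariant P Q L by apply: reach_invariant.
pose f' (x : stack_point n) := if x.1 is None then L x else f x.
have fP u : f' (upper u) = L (upper u).
  by case: u => [[] u] //; apply/esym/(Lo (false, u)).
have fo u : f' (outer u) = f (outer u) by case: u => [[] u].
rewrite -!fo; apply: H; split=> [x y xy|x y /same_mulP xy].
  by rewrite !fP; apply: LP.
pose f'' (x : stack_point n) :=
  if x.1 is Some false then L (None, x.2) else f x.
have fo' u : f'' (outer u) = f' (lower u) by case: u => [[] u].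
rewrite -!fo'; apply: xy; split=> [z t zt|z t zt].
  have fQ u : f'' (upper u) = L (lower u).
    by case: u => [[] u] //; apply/esym/(Lo (true, u)).
  by rewrite !fQ; apply: LQ.
have fR' u : f'' (lower u) = f (lower u) by case: u => [[] u].
by rewrite !fR'; apply: fR.
Qed.

(** Mirror image of [same_mulA1]: the hidden row is now the one between [Q] and [R]. *)
Lemma same_mulA2 v w : same (diagram_mul (diagram_mul P Q) R) v w ->
  same (diagram_mul P (diagram_mul Q R)) v w.
Proof.
move=> /same_mulP H; apply/same_mulP => f [fP fQR].
pose L := reach Q R (fun u => f (lower u)).
have Lo u : L (outer u) = f (lower u) by apply: reach_outer.
have [LQ LR] : stack_invariant Q R L by apply: reach_invariant.
pose f' (x : stack_point n) := if x.1 is None then L x else f x.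
have fR u : f' (lower u) = L (lower u).
  by case: u => [[] u] //; apply/esym/(Lo (true, u)).
have fo u : f' (outer u) = f (outer u) by case: u => [[] u].
rewrite -!fo; apply: H; split=> [x y /same_mulP xy|x y xy]; last first.
  by rewrite !fR; apply: LR.
pose f'' (x : stack_point n) :=
  if x.1 is Some true then L (None, x.2) else f x.
have fo' u : f'' (outer u) = f' (upper u) by case: u => [[] u].
rewrite -!fo'; apply: xy; split=> [z t zt|z t zt].
  have fP' u : f'' (upper u) = f (upper u) by case: u => [[] u].
  by rewrite !fP'; apply: fP.
have fQ u : f'' (lower u) = L (upper u).
  by case: u => [[] u] //; apply/esym/(Lo (false, u)).
by rewrite !fQ; apply: LQ.
Qed.
End Assoc.

Lemma diagram_mulA n : associative (@diagram_mul n).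
Proof.
move=> P Q R; apply: eq_diagram => v w.
by apply/idP/idP; [apply: same_mulA1|apply: same_mulA2].
Qed.

Lemma same_one n (v w : vertex n) : same (diagram_one n) v w = (v.2 == w.2).
Proof.
by rewrite (@same_mem _ _ _ _ (vertical v.2)) ?imset_f ?in_vertical // eq_sym.
Qed.

Lemma sameE n (P : diagram n) v w :
  same P v w = (pblock (val P) v == pblock (val P) w).
Proof.
have /and3P[/eqP cov triv _] := valP P.
by rewrite eq_pblock // cov inE.
Qed.

Lemma same_mul_eq n (P Q : diagram n) T (f : stack_point n -> T) v w :
  stack_invariant P Q f -> same (diagram_mul P Q) v w ->
  f (outer v) = f (outer w).
Proof. by move=> fPQ; rewrite same_mul; apply: connect_invariant. Qed.

Lemma diagram_mul1l n (P : diagram n) : diagram_mul (diagram_one n) P = P.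
Proof.
apply: eq_diagram => v w; apply/idP/idP => [|vw].
  pose f (x : stack_point n) := pblock (val P) (x.1 == Some true, x.2).
  have fl u : f (lower u) = pblock (val P) u by case: u => [[] u].
  have fo u : f (outer u) = pblock (val P) u by case: u => [[] u].
  rewrite (sameE P) -!fo => /same_mul_eq-> //; split=> x y.
    by rewrite same_one /f => /eqP; case: x => [[] i]; case: y => [[] j] /= ->.
  by rewrite !fl sameE => /eqP.
apply/same_mulP => f [f1 fP].
have fo u : f (outer u) = f (lower u).
  by case: u => [[] i] //; apply: (f1 (false, i) (true, i)); rewrite same_one.
by rewrite !fo; apply: fP.
Qed.

Lemma diagram_mul1r n (P : diagram n) : diagram_mul P (diagram_one n) = P.
Proof.
apply: eq_diagram => v w; apply/idP/idP => [|vw].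
  pose f (x : stack_point n) := pblock (val P) (x.1 != Some false, x.2).
  have fu u : f (upper u) = pblock (val P) u by case: u => [[] u].
  have fo u : f (outer u) = pblock (val P) u by case: u => [[] u].
  rewrite (sameE P) -!fo => /same_mul_eq-> //; split=> x y; last first.
    by rewrite same_one /f => /eqP; case: x => [[] i]; case: y => [[] j] /= ->.
  by rewrite !fu sameE => /eqP.
apply/same_mulP => f [fP f1].
have fo u : f (outer u) = f (upper u).
  by case: u => [[] i] //; apply: (f1 (true, i) (false, i)); rewrite same_one.
by rewrite !fo; apply: fP.
Qed.

(** * Induction over the generated submonoid *)

Lemma hook_blob_gen n (i : 'I_n) : gen i \in hook_blob n.
Proof.
by apply/bigcapP => M /andP[_ /subsetP sM]; apply: sM; apply: imset_f.
Qed.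

(** The diagrams [Q] with [X Q] contained in [X] form a submonoid, by associativity, and it contains
    the generators; apply its elements to the identity. *)
Lemma hook_blob_sub n (X : {set diagram n}) : diagram_one n \in X ->
  (forall P i, P \in X -> diagram_mul P (gen i) \in X) ->
  hook_blob n \subset X.
Proof.
move=> X1 Xgen; pose M := [set Q | [forall P in X, diagram_mul P Q \in X]].
apply: (@subset_trans _ _ (mem M)).
  apply: bigcap_inf; rewrite /submonoid; apply/andP; split; last first.
    apply/subsetP => _ /imsetP[i _ ->]; rewrite inE.
    by apply/forall_inP => P; apply: Xgen.
  rewrite inE; apply/andP; split.
    by apply/forall_inP => P; rewrite diagram_mul1r.
  apply/forall_inP => P /[!inE] /forall_inP MP.
  apply/forall_inP => Q /[!inE] /forall_inP MQ.
  by apply/forall_inP => S XS; rewrite diagram_mulA; apply/MQ/MP.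
apply/subsetP => Q /[!inE] /forall_inP/(_ _ X1).
by rewrite diagram_mul1l.
Qed.

(** A [Prop] predicate is no finite set, so [hook_blob_sub] is applied to the diagrams reachable
    from the identity by right multiplications. *)
Lemma hook_blob_ind n (X : diagram n -> Prop) : X (diagram_one n) ->
  (forall P i, X P -> X (diagram_mul P (gen i))) ->
  forall P, P \in hook_blob n -> X P.
Proof.
move=> X1 Xgen P HP.
pose e (Q S : diagram n) := [exists i, S == diagram_mul Q (gen i)].
have : P \in [set Q | connect e (diagram_one n) Q].
  apply: subsetP HP; apply: hook_blob_sub; first by rewrite inE connect0.
  move=> Q i; rewrite !inE => Q1; apply: connect_trans Q1 (connect1 _).
  by apply/existsP; exists i.
rewrite inE => /connectP[s es ->]; elim/last_ind: s es => // s Q IH.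
rewrite rcons_path last_rcons => /andP[/IH Xs /existsP[i /eqP->]].
exact: Xgen.
Qed.

(* Reading the points as 1, ..., n, n', ..., 1' puts them on a line; the two
   points 0 and 0' share the position 2n, on the far right. *)
Definition pos n (v : vertex n) : nat :=
  if v.2 == 0 :> nat then n.*2 else if v.1 then n.*2 - v.2 else v.2.-1.

Definition vtx n (p : nat) : vertex n :=
  if p < n then (false, inord p.+1)
  else if p < n.*2 then (true, inord (n.*2 - p)) else (false, ord0).

Lemma pos_le n (v : vertex n) : pos v <= n.*2.
Proof. by rewrite /pos; case: v => b [i /= lt]; case: ifP; case: b; lia. Qed.

Lemma vtxK n p : p <= n.*2 -> pos (vtx n p) = p.
Proof.
rewrite /vtx /pos => le; case: (ltnP p n) => lt; first by rewrite /= inordK.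
case: (ltnP p n.*2) => lt2 /=; last by lia.
by rewrite inordK; [case: eqP; lia|lia].
Qed.

Lemma posK n (v : vertex n) : v.2 != 0 :> nat -> vtx n (pos v) = v.
Proof.
case: v => b i; rewrite /pos /vtx /= => i0; have lt := ltn_ord i.
rewrite (negbTE i0); case: b.
  rewrite ifN ?ifT; try lia; congr pair; apply: val_inj.
  by rewrite /= inordK; lia.
by rewrite ifT; last lia; congr pair; apply: val_inj; rewrite /= inordK; lia.
Qed.

(** * Diagrams of matchings and their products with generators *)

Definition blocks_of n (m : nat -> nat) : {set {set vertex n}} :=
  preim_partition (fun v => link_class m (pos v)) setT.

Definition diag n (m : nat -> nat) : diagram n :=
  exist _ (blocks_of n m) (preim_partitionP _ _).

Lemma same_diag n N m (v w : vertex n) : nc N m ->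
  same (diag n m) v w = linked m (pos v) (pos w).
Proof.
move=> [_ mK _]; rewrite -link_classP // /same /=.
rewrite pblock_equivalence_partition //.
by move=> x y z _ _ _; split=> // /eqP->.
Qed.

Lemma eq_diag n N m1 m2 : nc N m1 -> m1 =1 m2 -> diag n m1 = diag n m2.
Proof.
move=> nc1 e; have nc2 := eq_nc e nc1; apply: eq_diagram => v w.
by rewrite (same_diag _ _ nc1) (same_diag _ _ nc2) /linked !e.
Qed.

Lemma same_gen0 n (i : 'I_n) v w : i = 0 :> nat ->
  same (gen i) v w = (v.2 <= 1) && (w.2 <= 1) || (v.2 == w.2).
Proof.
move=> i0; have gE : val (gen i) = gen_blocks n 0 by rewrite /= i0.
have [v1|v1] := leqP v.2 1.
  rewrite (@same_mem _ _ _ _ [set u : vertex n | u.2 <= 1]) ?inE //.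
    case: leqP => //= w1; apply/esym/eqP => e; rewrite e in v1; lia.
  by rewrite gE /gen_blocks /= !inE eqxx.
rewrite (@same_mem _ _ _ _ (vertical v.2)) ?in_vertical 1?eq_sym //.
by rewrite gE /gen_blocks /= !inE imset_f ?orbT // inE.
Qed.

Definition hooked (i k : nat) : bool := (k == i) || (k == i.+1).

Lemma same_genS n (i : 'I_n) v w : i != 0 :> nat ->
  same (gen i) v w =
  if hooked i v.2 then hooked i w.2 && (v.1 == w.1) else v.2 == w.2.
Proof.
move=> i0; rewrite /hooked.
have gE : val (gen i) = gen_blocks n i by [].
case vi: (_ || _).
  case v1: v.1.
    rewrite (@same_mem _ _ _ _ [set u : vertex n | u.1 &
      (u.2 == i :> nat) || (u.2 == i.+1 :> nat)]) ?inE ?v1 ?vi //.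
      by rewrite andbC; case: w.1.
    by rewrite gE /gen_blocks (negbTE i0) !inE eqxx ?orbT.
  rewrite (@same_mem _ _ _ _ [set u : vertex n | ~~ u.1 &
      (u.2 == i :> nat) || (u.2 == i.+1 :> nat)]) ?inE ?v1 ?vi //.
    by rewrite andbC; case: w.1.
  by rewrite gE /gen_blocks (negbTE i0) !inE eqxx ?orbT.
case: (posnP v.2) => v0.
  rewrite (@same_mem _ _ _ _ [set u : vertex n | u.2 == 0 :> nat]) ?inE ?v0 //.
    by rewrite -val_eqE /= v0 eq_sym.
  by rewrite gE /gen_blocks (negbTE i0) !inE eqxx.
rewrite (@same_mem _ _ _ _ (vertical v.2)) ?in_vertical 1?eq_sym //.
rewrite gE /gen_blocks (negbTE i0); apply/setUP; right.
by apply: imset_f; rewrite inE v0 /=; move/negbT: vi; rewrite negb_or.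
Qed.

Lemma pos_vtx n p : pos (vtx n p) = minn p n.*2.
Proof.
have [le|lt] := leqP p n.*2; first by rewrite vtxK.
by rewrite /vtx !ifN //; lia.
Qed.

(** Transfers a colouring from points to positions; positions beyond the special line take its
    colour, as all of them are fixed by [m]. *)
Lemma stack_sound n m (f : stack_point n -> bool) : nc n.*2 m ->
  (forall v w, same (diag n m) v w -> f (upper v) = f (upper w)) ->
  exists2 g : nat -> bool, (forall v, f (upper v) = g (pos v)) &
    forall p q, linked m p q -> g p = g q.
Proof.
move=> ncm fP; exists (fun p => f (upper (vtx n p))).
  move=> v; apply: fP; rewrite (same_diag _ _ ncm) pos_vtx.
  by rewrite (minn_idPl (pos_le v)) /linked eqxx.
have [mN mK _] := ncm; move=> p q pq; apply: fP.
rewrite (same_diag _ _ ncm) !pos_vtx; move: pq; rewrite /linked.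
have [pN|pN] := leqP p n.*2; have [qN|qN] := leqP q n.*2 => //.
- rewrite (mN q) ?(mN n.*2) ?eqxx ?andbT //; last by lia.
  move=> /or3P[/eqP e|/eqP e|->]; [lia| |by rewrite !orbT].
  by have := mK p; rewrite e mN; lia.
- rewrite (mN p) ?(mN n.*2) ?eqxx //; last by lia.
  by move=> /or3P[/eqP e|/eqP e|->]; [lia|lia|rewrite !orbT].
by rewrite eqxx.
Qed.

(** Primed points are read backwards, so (i+1)' comes just before i'. *)
Lemma pos_hooked n (i : 'I_n) (v : vertex n) : i != 0 :> nat ->
  (pos v \in [:: n.*2 - i.+1; (n.*2 - i.+1).+1]) = v.1 && hooked i v.2.
Proof.
rewrite /pos /hooked !inE => i0; have := ltn_ord i; have := ltn_ord v.2.
by case: ifP => [/eqP ->|]; case: v.1 => /=; lia.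
Qed.

(** [hook_act_complete] shows that the product links no more than the move does, [hook_act_sound]
    that it links no less. *)
Lemma diag_mul_hook n m (i : 'I_n) : nc n.*2 m -> i != 0 :> nat ->
  diagram_mul (diag n m) (gen i) = diag n (hook_act (n.*2 - i.+1) m).
Proof.
move=> ncm i0; set a := n.*2 - i.+1; have i_n := ltn_ord i.
have aN : a.+1 < n.*2 by rewrite /a; lia.
have nch := hook_act_nc aN ncm; set h := hook_act a m in nch *.
have [mN mK _] := ncm; have [hN hK _] := nch.
have pos_h (v : vertex n) := pos_hooked v i0; rewrite -/a in pos_h.
apply: eq_diagram => v w; rewrite (same_diag _ _ nch); apply/idP/idP.
  have [c cP] := hook_act_complete aN ncm.
  (* The hooked middle points get [c]; every other middle point is joined to the primed point below
     it and takes its colour. *)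
  pose f (x : stack_point n) := if (x.1 == None) && hooked i x.2 then c
    else link_class h (pos (x.1 != Some false, x.2)).
  have fu u : f (upper u) =
      if pos u \in [:: a; a.+1] then c else link_class h (pos u).
    by rewrite pos_h; case: u => [[] k].
  have fo u : f (outer u) = link_class h (pos u) by case: u => [[] k].
  move=> vw; rewrite -link_classP // -!fo; apply/eqP.
  apply: same_mul_eq vw; split=> x y.
    by rewrite (same_diag _ _ ncm) !fu => /cP.
  have lh : link_class h a = link_class h a.+1.
    by apply/eqP; rewrite link_classP // /linked /h hook_actl eqxx orbT.
  rewrite same_genS // /f.
  have fl (u : vertex n) : hooked i u.2 ->
      link_class h (pos (true, u.2)) = link_class h a.
    move=> uk; have := pos_h (true, u.2); rewrite /= uk !inE.
    by case/orP=> /eqP->.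
  case: (boolP (hooked i x.2)) => hx; last first.
    move/eqP=> e; rewrite /lower /= -e.
    by case: x.1; case: y.1; rewrite /= ?(negbTE hx) ?andbF.
  case/andP=> hy /eqP e; rewrite /lower -e.
  by case: x.1; rewrite /= ?hx ?hy //= !fl.
move=> vw; apply/same_mulP => f [fP fU].
have [g fg gm] := stack_sound ncm fP.
pose va : vertex n := (true, inord i.+1); pose vb : vertex n := (true, inord i).
have pa : pos va = a by rewrite /pos /va /= inordK.
have pb : pos vb = a.+1.
  by rewrite /pos /vb /= inordK ?(negbTE i0) /a; lia.
have gab : g a = g a.+1.
  suff: g (pos va) = g (pos vb) by rewrite pa pb.
  rewrite -!fg; apply: (fU (false, inord i.+1) (false, inord i)).
  by rewrite same_genS // /hooked !inordK ?eqxx ?orbT //; lia.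
have fo (u : vertex n) : pos u \notin [:: a; a.+1] -> f (outer u) = f (upper u).
  rewrite pos_h; case: u => [[] k] //= hk.
  by apply: (fU (true, k) (false, k)); rewrite same_genS // (negbTE hk) eqxx.
(* After the move [a] and [a.+1] form a block of their own, the lower half of the generator; it is
   treated separately. *)
have close p q : linked h p q -> p \in [:: a; a.+1] -> q \in [:: a; a.+1].
  have ha : h a = a.+1 by apply: hook_actl.
  have hb : h a.+1 = a by apply: hook_actr.
  rewrite /linked !inE => pq /orP[]/eqP e; move: pq; rewrite e ?ha ?hb.
    by case/or3P=> [/eqP<-|/eqP<-|/andP[/eqP]]; rewrite ?eqxx ?orbT //; lia.
  by case/or3P=> [/eqP<-|/eqP<-|/andP[/eqP]]; rewrite ?eqxx ?orbT //; lia.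
have [pv|pv] := boolP (pos v \in [:: a; a.+1]).
  have pw := close _ _ vw pv.
  move: pv pw; rewrite !pos_h => /andP[v1 hv] /andP[w1 hw].
  have ol (u : vertex n) : u.1 -> outer u = lower u by case: u => [[] k].
  by rewrite !ol //; apply: fU; rewrite same_genS // hv hw v1 w1.
have pw : pos w \notin [:: a; a.+1].
  by apply: contra pv; apply: close; rewrite -link_classP // eq_sym link_classP.
by rewrite !fo // !fg; apply: (hook_act_sound mK gm gab).
Qed.

(** Same scheme as [diag_mul_hook], but here every middle point is joined to the primed point below
    it, so no extra colour is needed. *)
Lemma diag_mul_blob n m (i : 'I_n) : nc n.*2 m -> i = 0 :> nat ->
  diagram_mul (diag n m) (gen i) = diag n (blob_act n.*2.-1 m).
Proof.
move=> ncm i0; have i_n := ltn_ord i; set a := n.*2.-1.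
have aE : n.*2 = a.+1 by rewrite /a; lia.
have ncm1 : nc a.+1 m by rewrite -aE.
have nch := blob_act_nc ncm1; have hl := blob_act_link ncm1.
have bs (T : Type) (f : nat -> T) := @blob_act_sound T a m f ncm1.
have bc p q := @blob_act_complete a m p q ncm1.
rewrite -!aE in nch hl bs; set h := blob_act a m in nch hl bc bs *.
have [mN mK _] := ncm; have [hN hK _] := nch.
apply: eq_diagram => v w; rewrite (same_diag _ _ nch); apply/idP/idP.
  pose f (x : stack_point n) := link_class h (pos (x.1 != Some false, x.2)).
  have fu u : f (upper u) = link_class h (pos u) by case: u => [[] k].
  have fo u : f (outer u) = link_class h (pos u) by case: u => [[] k].
  move=> vw; rewrite -link_classP // -!fo; apply/eqP.
  apply: same_mul_eq vw; split=> x y.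
    rewrite (same_diag _ _ ncm) !fu => xy.
    by apply/eqP; rewrite link_classP //; apply: bc.
  have fl u : f (lower u) = link_class h (pos (true, u.2)) by case: u => [[] k].
  rewrite same_gen0 // !fl => /orP[/andP[x1 y1]|/eqP-> //].
  have l1 (k : 'I_n.+1) : k <= 1 ->
      link_class h (pos ((true, k) : vertex n)) = link_class h a.
    move=> u1; rewrite /pos /=; case: (eqVneq (k : nat) 0) => [u0|/eqP u0].
      by apply/esym/eqP; rewrite link_classP.
    by congr link_class; rewrite /a; lia.
  by rewrite !l1.
move=> vw; apply/same_mulP => f [fP fU].
have [g fg gm] := stack_sound ncm fP.
have fo (u : vertex n) : f (outer u) = f (upper u).
  case: u => [[] k] //.
  by apply: (fU (true, k) (false, k)); rewrite same_gen0 // eqxx orbT.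
pose va : vertex n := (true, inord 1); pose vb : vertex n := (true, ord0).
have pa : pos va = a by rewrite /pos /va /= inordK /= /a; lia.
have gab : g a = g n.*2.
  suff: g (pos va) = g (pos vb) by rewrite pa.
  rewrite -!fg; apply: (fU (false, inord 1) (false, ord0)).
  by rewrite same_gen0 // inordK //; lia.
by rewrite !fo !fg; apply: bs vw.
Qed.

(** The matching of the identity diagram: nested arcs from k to k'. *)
Definition flip N p := if p < N then N - p.+1 else p.

Lemma flip_nc n : nc n.*2 (flip n.*2).
Proof.
rewrite /flip; split=> [p pN|p|p q].
- by rewrite ifN // -leqNgt.
- case: (ltnP p n.*2) => pN; last by rewrite ifN // -leqNgt.
  by rewrite ifT; lia.
- case: (ltnP p n.*2) => pN; last by lia.
  by move=> pq; rewrite ifT; lia.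
Qed.

Lemma flip_pos n (v : vertex n) : flip n.*2 (pos v) = pos (~~ v.1, v.2).
Proof.
rewrite /pos /flip /=; case: v => b k /=; have := ltn_ord k.
case: (eqVneq (k : nat) 0) => [_|/eqP k0] kn; first by rewrite ltnn.
by case: b => /=; rewrite ifT; lia.
Qed.

Lemma pos_inj n (v w : vertex n) : v.2 != 0 :> nat -> pos v = pos w -> v = w.
Proof.
move=> v0 e; have w0 : w.2 != 0 :> nat.
  apply: contraNneq v0 => w0; move: e; rewrite /pos w0 /=.
  case: v => b k /=; have := ltn_ord k.
  by case: (eqVneq (k : nat) 0) => // k0; case: b; lia.
by rewrite -(posK v0) e posK.
Qed.

Lemma diag_flip n : diag n (flip n.*2) = diagram_one n.
Proof.
apply: eq_diagram => v w; rewrite (same_diag _ _ (flip_nc _)) same_one.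
rewrite /linked !flip_pos; apply/idP/eqP => [|e].
  case: (eqVneq (v.2 : nat) 0) => v0.
    case: (eqVneq (w.2 : nat) 0) => w0; first by move=> _; apply: val_inj; rewrite /= v0 w0.
    case/or3P=> [/eqP/esym/pos_inj->//|/eqP/esym/pos_inj e|/andP[_ /eqP/esym/pos_inj e]].
      by rewrite e.
    by have /= := congr1 fst (e w0); case: (w.1).
  case/or3P=> [/eqP/pos_inj->//|/eqP/pos_inj e|/andP[/eqP/esym/pos_inj e _]].
    by rewrite -e.
  by have /= := congr1 fst (e v0); case: (v.1).
case: v w e => b k [c l] /= <-; case: (b =P c) => [->|ne]; first by rewrite eqxx.
have -> : c = ~~ b by case: b c ne => [] [].
by rewrite eqxx orbT.
Qed.

Lemma hook_blob_nc n (P : diagram n) : P \in hook_blob n ->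
  exists2 m, nc n.*2 m & P = diag n m.
Proof.
elim/hook_blob_ind => [|{}P i [m ncm ->]].
  by exists (flip n.*2); [apply: flip_nc|rewrite diag_flip].
have i_n := ltn_ord i; case: (eqVneq (i : nat) 0) => i0.
  exists (blob_act n.*2.-1 m); last by apply: diag_mul_blob.
  by have := @blob_act_nc n.*2.-1 m; rewrite prednK; [apply|lia].
exists (hook_act (n.*2 - i.+1) m); last by apply: diag_mul_hook.
by apply: hook_act_nc => //; lia.
Qed.

(** * Generation by local moves *)

Definition reached n (w : seq bool) : Prop :=
  exists m, [/\ nc n.*2 m, word n.*2 m = w & diag n m \in hook_blob n].

Lemma letterE N m w p : word N m = w -> p < N -> (p <= m p) = nth true w p.
Proof. by move=> <- pN; rewrite nth_mkseq. Qed.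

Lemma reached_size n w : reached n w -> size w = n.*2.
Proof. by case=> m [_ <- _]; rewrite size_mkseq. Qed.

Lemma eq_word_nth N m w : size w = N ->
  (forall p, p < N -> (p <= m p) = nth true w p) -> word N m = w.
Proof.
move=> sw H; apply: (@eq_from_nth _ true); rewrite size_mkseq // => p pN.
by rewrite nth_mkseq // H.
Qed.

(** Right multiplication hooks only primed points, whence [n <= a]. *)
Lemma mul_hook_gen n m a : nc n.*2 m -> n <= a -> a.+1 < n.*2 ->
  diag n m \in hook_blob n -> diag n (hook_act a m) \in hook_blob n.
Proof.
move=> ncm na aN Hm; have iP : n.*2 - a.+1 < n by lia.
have -> : hook_act a m = hook_act (n.*2 - (Ordinal iP).+1) m by congr hook_act => /=; lia.
rewrite -diag_mul_hook //; last by rewrite /=; lia.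
by apply: hook_blob_mul => //; apply: hook_blob_gen.
Qed.

Lemma nth_cat_add (x y : seq bool) k : nth true (x ++ y) (size x + k) = nth true y k.
Proof. by rewrite nth_cat ltnNge leq_addr /= addKn. Qed.

(** The second letter starts an arc or is unmatched, so hooking the two positions turns the valley
    into a peak and keeps all other letters. *)
Lemma reached_hook n x y : n <= size x ->
  reached n (x ++ [:: false, true & y]) -> reached n (x ++ [:: true, false & y]).
Proof.
move=> nx Hw; have := reached_size Hw; rewrite size_cat /= => sw.
case: Hw => m [ncm wm Hm]; have [_ mK mc] := ncm.
have aN : (size x).+1 < n.*2 by lia.
exists (hook_act (size x) m); split; first exact: hook_act_nc.
  have l1 := letterE wm (ltnW aN); have l2 := letterE wm aN.
  rewrite -[in nth _ _ _](addn0 (size x)) nth_cat_add /= in l1.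
  rewrite -[in nth _ _ _](addn1 (size x)) nth_cat_add /= in l2.
  apply: eq_word_nth => [|p pN]; first by rewrite size_cat.
  rewrite nth_cat; case: (eqVneq p (size x)) => [->|pa].
    by rewrite hook_actl ltnn subnn leqnSn.
  case: (eqVneq p (size x).+1) => [->|pb].
    by rewrite hook_actr ltnn -nth_cat -[in nth _ _ _]addn1 nth_cat_add.
  rewrite hook_act_letters //; try lia; rewrite ifN; last by lia.
  rewrite (letterE wm pN) nth_cat; case: ltnP => // xp.
  by case: (p - size x) (subnKC xp) => [|[|k]] //= e; lia.
exact: mul_hook_gen.
Qed.

(** The two closing letters after the nest end nested arcs. Hooking them links the left ends of
    these arcs, and the inner left end becomes a closing letter. It may lie in the unprimed half,
    which is how letters there get changed. *)
Lemma reached_cap n x t y : n <= size x + t.*2.+1 ->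
  reached n (x ++ true :: nseq t true ++ nseq t false ++ [:: false, false & y]) ->
  reached n (x ++ false :: nseq t true ++ nseq t false ++ [:: true, false & y]).
Proof.
move=> na Hw; have := reached_size Hw.
rewrite !size_cat /= !size_cat !size_nseq /= => sw.
case: Hw => m [ncm wm Hm]; have [_ mK mc] := ncm.
(* [a] closes the arc from [size x], and [c] is where the closing letters of the pattern begin. *)
set a := size x + t.*2.+1; have aN : a.+1 < n.*2 by rewrite /a; lia.
set c := size x + t.+1.
have lw p z : p < n.*2 -> nth true (x ++ (z.1 : bool) :: nseq t true ++ nseq t false ++
    [:: (z.2 : bool), false & y]) p =
  if p < size x then nth true x p else if p == size x then z.1
  else if p < c then true else if p < a then false else if p == a then z.2
  else if p == a.+1 then false else nth true y (p - a.+2).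
  move=> pN; rewrite nth_cat; case: ltnP => // xp; rewrite /c /a.
  case: (eqVneq p (size x)) => [->|px]; first by rewrite subnn.
  have -> : p - size x = (p - (size x).+1).+1 by lia.
  rewrite /= nth_cat size_nseq nth_nseq if_same; case: ltnP => h1.
    by rewrite ifT //; lia.
  rewrite ifN; last by lia.
  rewrite nth_cat size_nseq nth_nseq; case: ltnP => h2; first by rewrite ifT //; lia.
  rewrite ifN; last by lia.
  case: (eqVneq p _) => [->|h3].
    by rewrite (_ : _ - _ = 0) //; lia.
  case: (eqVneq p _) => [->|h4].
    by rewrite (_ : _ - _ = 1) //; lia.
  by rewrite (_ : _ - _ = (p - (size x + t.*2.+1).+2).+2) //; lia.
have lm p : p < n.*2 -> _ := fun pN => etrans (letterE wm pN) (lw p (true, false) pN).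
have ma : m a = size x.
  have -> : a = c + t by rewrite /a /c; lia.
  have -> : size x = c - t.+1 by rewrite /c; lia.
  apply: nested_partner ncm _ _; last by rewrite /c; lia.
  move=> j jt; rewrite (ltnNge (m _)) !lm /=; try (rewrite /c; lia).
  split.
    rewrite ifN; last by rewrite /c; lia.
    by case: eqP => // _; rewrite ifT // /c; lia.
  do 3 (rewrite ifN; last by rewrite /c; lia).
  by case: ltnP => // h; rewrite ifT //; rewrite /a /c in h *; lia.
(* A partner strictly between [size x] and [a] would lie under the arc joining these two, which
   [a.+1] is not. *)
have mb : m a.+1 < size x.
  have lb : m a.+1 < a.+1.
    rewrite ltnNge lm //=.
    do 5 (rewrite ifN; last by rewrite /a /c; lia).
    by rewrite eqxx.
  rewrite ltnNge; apply/negP => xb.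
  have ne1 : m a.+1 <> m a by move=> /(inv_inj mK); lia.
  have ne2 : m a.+1 <> a by move=> e; have := mK a.+1; rewrite e ma /a; lia.
  have [|] := mc (m a) (m a.+1); rewrite !mK; lia.
exists (hook_act a m); split; first exact: hook_act_nc.
  apply: eq_word_nth => [|p pN]; first by rewrite !size_cat /= !size_cat !size_nseq /=; lia.
  have /= -> := lw p (false, true) pN.
  case: (eqVneq p a) => [->|pa].
    rewrite hook_actl leqnSn.
    by do 4 (rewrite ifN; last by rewrite /a /c; lia).
  case: (eqVneq p a.+1) => [->|pb].
    rewrite hook_actr ltnn.
    by do 4 (rewrite ifN; last by rewrite /a /c; lia).
  have h1 : m a < a by rewrite ma /a; lia.
  have h2 : a < m a.+1 \/ m a.+1 < m a by right; rewrite ma.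
  rewrite hook_act_letters //.
  rewrite ma mb /= lm //=; case: (eqVneq p (size x)) => [->|px].
    by rewrite ltnn.
  by rewrite (negbTE pa) (negbTE pb).
exact: mul_hook_gen.
Qed.

(** The last position and its partner become unmatched; the partner keeps its opening letter. *)
Lemma reached_blob n x : 0 < n ->
  reached n (rcons x false) -> reached n (rcons x true).
Proof.
move=> n0 Hw; have := reached_size Hw; rewrite size_rcons => sw.
case: Hw => m [ncm wm Hm]; have [_ mK mc] := ncm.
have ncm1 : nc (size x).+1 m by rewrite sw.
exists (blob_act (size x) m); split; first by rewrite -sw; apply: blob_act_nc.
  apply: eq_word_nth => [|p pN]; first by rewrite size_rcons.
  rewrite nth_rcons /blob_act.
  have := letterE wm pN; rewrite nth_rcons.
  case: (eqVneq p (size x)) => [->|px]; first by rewrite ltnn leqnn.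
  have px' : p < size x by lia.
  by rewrite px'; case: (eqVneq (m p) (size x)) => [->|_] <- //=; lia.
have -> : blob_act (size x) m = blob_act n.*2.-1 m by rewrite -sw.
rewrite -(diag_mul_blob (i := Ordinal n0)) //.
by apply: hook_blob_mul => //; apply: hook_blob_gen.
Qed.

(* The lowest ballot word of l letters from height h. *)
Fixpoint greedy h l : seq bool :=
  if l is l'.+1 then
    if h is h'.+1 then false :: greedy h' l' else true :: greedy 1 l'
  else [::].

Lemma size_greedy h l : size (greedy h l) = l.
Proof. by elim: l h => //= l IH [|h] /=; rewrite IH. Qed.

(** The opening letter is first produced one place further right, by recursion on [h] or by the blob
    generator at the very end, and then moved left by [reached_hook]. *)
Lemma reached_greedy_true n x h l : 0 < n -> n <= size x ->
  reached n (x ++ greedy h l.+1) -> reached n (x ++ true :: greedy h.+1 l).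
Proof.
move=> n0; elim: h l x => [|h IH] l x nx //=.
case: l => [|l] /=; first by rewrite !cats1; apply: reached_blob.
move=> H; apply: reached_hook => //.
rewrite -cat_rcons; apply: IH; first by rewrite size_rcons; lia.
by rewrite cat_rcons.
Qed.

Lemma reached_greedy n x h y : 0 < n -> n <= size x -> ballot h y ->
  reached n (x ++ greedy h (size y)) -> reached n (x ++ y).
Proof.
move=> n0; elim: y h x => [|c y IH] h x nx //= by_ H.
rewrite -cat_rcons; have nx' : n <= size (rcons x c) by rewrite size_rcons; lia.
case: c by_ nx' H => [by_|/andP[h0 by_]] nx' H.
  by apply: (IH h.+1) => //; rewrite cat_rcons; apply: reached_greedy_true.
by apply: (IH h.-1) => //; rewrite cat_rcons; case: h h0 H {by_}.
Qed.

(** The peak passes one closing letter at a time, by [reached_cap] with an empty nest. *)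
Lemma reached_shift n x k y : n <= size x ->
  reached n (x ++ [:: true, false & nseq k false ++ y]) ->
  reached n (x ++ nseq k false ++ [:: true, false & y]).
Proof.
elim: k x => [//|k IH] x nx /= H.
rewrite -cat_rcons; apply: IH; first by rewrite size_rcons; lia.
rewrite cat_rcons; apply: (@reached_cap n x 0) => //; rewrite /=; lia.
Qed.

Lemma ballot_nseq_true h t y : ballot h (nseq t true ++ y) = ballot (h + t) y.
Proof. by elim: t h => [|t IH] h /=; rewrite ?addn0 // IH addnS. Qed.

Lemma ballot_nseq_false h t y : ballot (h + t) (nseq t false ++ y) = ballot h y.
Proof. by elim: t h => [|t IH] h /=; rewrite ?addn0 // addnS /= IH. Qed.

Lemma ballot_greedy h l : ballot h (greedy h l).
Proof. by elim: l h => //= l IH [|h] /=. Qed.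

Lemma greedy_cat h l : greedy h (h + l) = nseq h false ++ greedy 0 l.
Proof. by elim: h => //= h ->. Qed.

Lemma reached_flip n : reached n (nseq n true ++ nseq n false).
Proof.
exists (flip n.*2); split; first exact: flip_nc.
  apply: eq_word_nth => [|p pN]; first by rewrite size_cat !size_nseq addnn.
  rewrite nth_cat size_nseq !nth_nseq /flip pN.
  by case: ltnP => pn; [|rewrite ifT]; lia.
by rewrite diag_flip hook_blob_one.
Qed.

Lemma last_false x : 0 < count negb x ->
  exists x' t, x = x' ++ false :: nseq t true.
Proof.
elim/last_ind: x => [//|x [] IH]; rewrite -cats1 count_cat /= ?addn0 => lt.
  have [x' [t ->]] := IH lt; exists x', t.+1.
  by rewrite -catA /= -[[:: true]]/(nseq 1 true) -nseqD addn1.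
by exists x, 0.
Qed.

(** Induction on the number of closing letters in the unprimed half. The primed half may be taken
    greedy by [reached_greedy]; without closing letters in [x] the word is then that of the
    identity. *)
Lemma reached_ballot n x y : 0 < n -> size x = n -> size y = n ->
  ballot 0 (x ++ y) -> reached n (x ++ y).
Proof.
move=> n0; have [k] := ubnP (count negb x); elim: k x y => // k IH x y kx sx sy.
rewrite ballot_cat add0n => /andP[bx by_].
have cx : count id x + count negb x = n by rewrite -sx -(count_predC id).
apply: (reached_greedy n0 _ by_); first by rewrite sx.
rewrite sy.
have [x0|x0] := posnP (count negb x).
  have xE : x = nseq n true.
    rewrite -sx; apply/all_pred1P; have : all id x by rewrite all_count sx; lia.
    by apply: sub_all => -[].
  rewrite x0 subn0 (_ : count id x = n); last by lia.
  have -> : greedy n n = nseq n false by have := greedy_cat n 0; rewrite addn0 cats0.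
  by rewrite xE; apply: reached_flip.
(* The last closing letter of [x] is the one that [reached_cap] will have produced. *)
have [x' [t xE]] := last_false x0; subst x.
set p := count id x'; set q := count negb x'.
have [c1 c2] : count id (false :: nseq t true) = t /\
    count negb (false :: nseq t true) = 1 by rewrite /= !count_nseq; lia.
move: bx kx sx cx; rewrite ballot_cat !count_cat size_cat c1 c2 -/p -/q add0n.
rewrite /= size_nseq => /and3P[bx' pq _] kx sx cx.
(* The height after [x'] is [e.+1], positive since a closing letter follows; after [x] it is
   [t + e], from which the greedy half descends. *)
have [e pE] : exists e, p = q + e.+1 by exists (p - q.+1); lia.
have [l nE] : exists l, n = t + e + l.+2 by exists (n - (t + e).+2); lia.
have -> : p + t - (q + 1) = t + e by lia.
have -> : greedy (t + e) n =
    nseq t false ++ nseq e false ++ [:: true, false & greedy 0 l].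
  by rewrite {1}nE greedy_cat nseqD -catA.
have -> : (x' ++ false :: nseq t true) ++
    nseq t false ++ nseq e false ++ [:: true, false & greedy 0 l] =
  (x' ++ false :: nseq t true ++ nseq t false) ++
    nseq e false ++ [:: true, false & greedy 0 l].
  by rewrite -!catA /= -!catA.
apply: reached_shift; first by rewrite size_cat /= size_cat !size_nseq; lia.
rewrite -catA /= -catA; apply: reached_cap; first by lia.
(* In the word before the cap move that closing letter is still an opening one. *)
have := IH (x' ++ true :: nseq t true)
  (nseq t false ++ [:: false, false & nseq e false ++ greedy 0 l]).
rewrite -catA /=; apply.
- by rewrite count_cat /= count_nseq -/q; lia.
- by rewrite size_cat /= size_nseq; lia.
- by rewrite size_cat /= size_cat !size_nseq size_greedy; lia.
rewrite ballot_cat bx' add0n -/p -/q (_ : p - q = e.+1) /=; last by lia.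
rewrite ballot_nseq_true ballot_nseq_false /=.
by rewrite -[e]add0n ballot_nseq_false ballot_greedy.
Qed.

(** * Blocks and closing letters *)

Lemma diag_hook_blob n m : 0 < n -> nc n.*2 m -> diag n m \in hook_blob n.
Proof.
move=> n0 ncm; set w := word n.*2 m.
have sw : size w = n.*2 by rewrite size_mkseq.
have : reached n (take n w ++ drop n w).
  apply: reached_ballot; rewrite ?size_take ?size_drop ?sw ?cat_take_drop //.
  - by rewrite ifT //; lia.
  - by lia.
  - exact: word_ballot.
rewrite cat_take_drop => -[m' [ncm' wm' Hm']].
by rewrite (eq_diag n ncm (nc_word_inj ncm ncm' (esym wm'))).
Qed.

Lemma same_diag_vtx n m p q : nc n.*2 m -> p <= n.*2 -> q <= n.*2 ->
  same (diag n m) (vtx n p) (vtx n q) = linked m p q.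
Proof. by move=> ncm pN qN; rewrite (same_diag _ _ ncm) !vtxK. Qed.

Lemma card_diag n m : nc n.*2 m ->
  #|val (diag n m)| = (count negb (word n.*2 m)).+1.
Proof.
move=> ncm; have [mN mK mc] := ncm.
(* One representative per block: right ends for arcs, the special line for the block of 0 and 0'. *)
pose s := n.*2 :: [seq p <- iota 0 n.*2 | m p < p].
have sP p : p \in s -> (p = n.*2) \/ (p < n.*2 /\ m p < p).
  rewrite inE mem_filter mem_iota add0n /= => /orP[/eqP->|/andP[-> ->]]; first by left.
  by right.
pose blk p := pblock (val (diag n m)) (vtx n p).
have -> : (count negb (word n.*2 m)).+1 = size (map blk s).
  rewrite size_map /= size_filter count_map; congr _.+1.
  by apply: eq_count => p /=; rewrite ltnNge.
have /and3P[/eqP cov triv n0] := valP (diag n m).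
have us : uniq (map blk s).
  rewrite map_inj_in_uniq; last first.
    move=> p q ps qs /eqP; rewrite -sameE.
    have [pN qN] : p <= n.*2 /\ q <= n.*2 by case: (sP _ ps); case: (sP _ qs); lia.
    rewrite same_diag_vtx // => /or3P[/eqP//|/eqP e|/andP[/eqP e1 /eqP e2]].
      have e' : m q = p by rewrite -e mK.
      have := mN p; have := mN q.
      by case: (sP _ ps) => [f|[f1 f2]]; case: (sP _ qs) => [g|[g1 g2]]; lia.
    by case: (sP _ ps); case: (sP _ qs); lia.
  by rewrite /= mem_filter mem_iota add0n ltnn !andbF filter_uniq // iota_uniq.
rewrite -(card_uniqP us); apply: eq_card => B; apply/idP/mapP => [PB|[p _ ->]]; last first.
  by rewrite pblock_mem // cov inE.
have [v vB] : exists v, v \in B by apply/set0Pn; apply: contraNneq n0 => <-.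
have PBE u : linked m (pos v) (pos u) -> B = pblock (val (diag n m)) u.
  rewrite -(same_diag _ _ ncm) sameE => /eqP <-.
  by rewrite (def_pblock triv PB vB).
have vN := pos_le v.
have [lt|lt|e] := ltngtP (m (pos v)) (pos v).
- exists (pos v); last by apply: PBE; rewrite vtxK // /linked eqxx.
  rewrite inE mem_filter lt mem_iota add0n /=.
  by case: (eqVneq (pos v) n.*2) => //= /eqP ne; lia.
- have mv : m (pos v) < n.*2.
    by apply: nc_lt ncm _; have := mN (pos v); lia.
  exists (m (pos v)); last by apply: PBE; rewrite vtxK 1?ltnW // /linked eqxx orbT.
  by rewrite inE mem_filter mK lt mem_iota add0n mv orbT.
- exists n.*2; first by rewrite inE eqxx.
  by apply: PBE; rewrite vtxK // /linked (mN n.*2) // e !eqxx !orbT.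
Qed.

(** Defined on the diagram itself, so that no matching has to be chosen. Comparison with
    [vtx n n.*2] keeps the unmatched positions opening. *)
Definition diagram_word n (P : diagram n) : (n.*2).-tuple bool :=
  [tuple ~~ [exists q : 'I_n.*2, [&& q < p, same P (vtx n q) (vtx n p)
     & ~~ same P (vtx n p) (vtx n n.*2)]] | p < n.*2].

Lemma diagram_word_diag n m : nc n.*2 m ->
  diagram_word (diag n m) = word n.*2 m :> seq bool.
Proof.
move=> ncm; have [mN mK mc] := ncm; apply/esym/eq_word_nth => [|p pN].
  by rewrite size_tuple.
rewrite -[p]/(nat_of_ord (Ordinal pN)) -tnth_nth tnth_mktuple.
rewrite /= leqNgt; congr (~~ _); apply/idP/existsP => [lt|[q /and3P[qp]]].
  exists (Ordinal (ltn_trans lt pN)); rewrite !same_diag_vtx //=; try lia.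
  rewrite lt /linked mK eqxx orbT /=; apply/negP.
  by case/or3P=> [/eqP e|/eqP e|/andP[/eqP e _]]; lia.
have qN := ltn_ord q; rewrite !same_diag_vtx //=; try lia.
rewrite /linked (mN n.*2) // eqxx andbT.
case/or3P=> [/eqP|/eqP e|/andP[/eqP e1 /eqP e2]]; first by rewrite /= in qp *; lia.
  by move=> _; rewrite -e mK e.
by rewrite e2 eqxx !orbT.
Qed.

Lemma sum_hook_blob (T : nmodType) n (F : nat -> T) : 0 < n ->
  (\sum_(P in hook_blob n) F #|val P| =
   \sum_(w : (n.*2).-tuple bool | ballot 0 w) F (count negb w).+1)%R.
Proof.
move=> n0; pose W := [set w : (n.*2).-tuple bool | ballot 0 w].
have WE : W = (@diagram_word n) @: (hook_blob n : {set diagram n}).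
  apply/setP => w; rewrite inE; apply/idP/imsetP => [bw|[P HP ->]].
    have [m] := ballot_word bw; rewrite size_tuple => ncm wm.
    exists (diag n m); first exact: diag_hook_blob.
    by apply: val_inj; rewrite /= diagram_word_diag.
  have [m ncm ->] := hook_blob_nc HP; rewrite diagram_word_diag //.
  exact: word_ballot.
have -> : (\sum_(w : (n.*2).-tuple bool | ballot 0 w) F (count negb w).+1 =
    \sum_(w in W) F (count negb w).+1)%R by apply: eq_bigl => w; rewrite inE.
rewrite WE big_imset /=.
  apply: eq_bigr => P HP; have [m ncm ->] := hook_blob_nc HP.
  by rewrite card_diag // diagram_word_diag.
move=> P Q HP HQ /(congr1 val) /=.
have [m ncm ->] := hook_blob_nc HP; have [m' ncm' ->] := hook_blob_nc HQ.
rewrite !diagram_word_diag // => e.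
exact: eq_diag ncm (nc_word_inj ncm ncm' e).
Qed.

(** * Indexing matrices and ballot words *)

(* A pair of subsets of [0, n-1] and [1, n-1], read from the top value down. *)
Definition bit n (r s : seq nat) (p : nat) : bool :=
  if odd p then n - p./2.+1 \in r else n - p./2 \notin s.

Lemma count_leqS (r : seq nat) x : count_mem x r = (x \in r) ->
  count (leq x) r = count (leq x.+1) r + (x \in r).
Proof.
move=> <-; rewrite addnC -count_predUI.
rewrite [X in _ + X](_ : _ = 0) ?addn0.
  by apply: eq_count => y /=; rewrite leq_eqVlt eq_sym.
apply/eqP; rewrite -leqn0 leqNgt -has_count; apply/hasPn => y _ /=.
by case: eqP => //= ->; rewrite ltnn.
Qed.

(** A closing letter records a value missing from [r] or present in [s], so the memberships in [r]
    cancel at each step of [j]. *)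
Lemma count_bits n r s j : uniq r -> uniq s -> all (gtn n) r -> all (gtn n) s ->
  j <= n ->
  count (fun p => ~~ bit n r s p) (iota 0 j.*2) + count (leq (n - j)) r =
  j + count (leq (n - j).+1) s.
Proof.
move=> ur us rn sn; elim: j => [_|j IH jn].
  rewrite subn0 /= add0n; apply/eqP; rewrite [X in _ == X](_ : _ = 0) -?leqn0.
    rewrite leqNgt -has_count; apply/hasPn => x xr; have /= := allP rn x xr.
    by rewrite ltnNge.
  apply/eqP; rewrite -leqn0 leqNgt -has_count; apply/hasPn => x xs /=.
  by have /= := allP sn x xs; rewrite -leqNgt; apply: leqW.
rewrite doubleS -addn2 iotaD count_cat /= addn0 /bit /= odd_double /= uphalf_double doubleK.
rewrite negbK ?add0n.
have := IH (ltnW jn).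
have nE : n - j = (n - j.+1).+1 by lia.
rewrite [count (leq (n - j.+1)) r]count_leqS ?count_uniq_mem // -nE.
rewrite [count (leq (n - j)) s]count_leqS ?count_uniq_mem //.
by case: (n - j.+1 \in r); case: (n - j \in s); rewrite /bit /=; lia.
Qed.

Lemma count_bits_odd n r s j : uniq r -> uniq s -> all (gtn n) r -> all (gtn n) s ->
  j <= n ->
  count (fun p => ~~ bit n r s p) (iota 0 j.*2.+1) + count (leq (n - j)) r =
  j + count (leq (n - j)) s.
Proof.
move=> ur us rn sn jn; rewrite -addn1 iotaD count_cat /= addn0 add0n.
rewrite addnAC count_bits // /bit odd_double negbK doubleK.
by rewrite [count (leq (n - j)) s]count_leqS ?count_uniq_mem // addnA.
Qed.

Lemma count_id_negb (w : seq bool) : count id w + count negb w = size w.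
Proof. by rewrite -(count_predC id). Qed.

(** By [count_bits_odd], the prefix of length 2j+1 has at most j closing letters exactly when the
    inequality holds at x = n - j. Even prefixes follow, since lowering the threshold on [r] only
    increases its count. *)
Lemma ballot_bits n r s : uniq r -> uniq s -> all (gtn n) r -> all (gtn n) s ->
  reflect (forall x, 0 < x <= n -> count (leq x) s <= count (leq x) r)
    (ballot 0 (mkseq (bit n r s) n.*2)).
Proof.
move=> ur us rn sn; set w := mkseq _ _.
have ctake p : p <= n.*2 -> count negb (take p w) =
    count (fun p => ~~ bit n r s p) (iota 0 p).
  by move=> pn; rewrite -map_take take_iota (minn_idPl pn) count_map.
have cid p : p <= n.*2 -> count id (take p w) + count negb (take p w) = p.
  by move=> pn; rewrite count_id_negb size_takel // size_mkseq.
apply: (iffP (ballotP _ _)) => H.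
  move=> x /andP[x0 xn]; have := H (n - x).*2.+1; have := cid (n - x).*2.+1.
  rewrite ctake; last by lia.
  have := @count_bits_odd n r s (n - x) ur us rn sn (leq_subr _ _); rewrite subKn //.
  by lia.
have {}H p : p <= n.*2 -> count negb (take p w) <= 0 + count id (take p w).
  move=> pn; have := cid p pn; rewrite ctake //.
  have [->|p0] := posnP p; first by lia.
  move: (odd p) (p./2) (odd_double_half p) => b j pE.
  have jn : j <= n by case: b pE => /=; lia.
  have Hj := H (n - j); case: b pE => [|] pE; subst p; rewrite ?add1n ?add0n in pn p0 *.
    by have := count_bits_odd ur us rn sn jn; lia.
  have := count_bits ur us rn sn jn; have HjS := H (n - j).+1.
  have := @count_leqS r (n - j); rewrite count_uniq_mem // => /(_ erefl).
  by lia.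
move=> p; have [pn|pn] := leqP p n.*2; first exact: H.
by have := H n.*2 (leqnn _); rewrite !take_oversize ?size_mkseq // ltnW.
Qed.

Definition zero_strict (x y : nat) : bool := (x <= y) && ((x == y) ==> (x == 0)).

(* The degenerate matrix corresponds to empty rows. *)
Definition index_rows n (r s : seq nat) : bool :=
  [&& size r == size s, pairwise ltn r, all (gtn n) r, pairwise zero_strict s
    & all2 leq s r].

Lemma zero_strict_pos s : pairwise zero_strict s -> pairwise ltn (filter (leq 1) s).
Proof.
elim: s => //= x s IH /andP[xs /IH ps]; case: ifP => //= x0; rewrite ps andbT.
apply/allP => y; rewrite mem_filter => /andP[y0 ys].
by have := allP xs y ys; rewrite /zero_strict; case: (eqVneq x y) => /=; lia.
Qed.

Lemma pairwise_ltn_uniq s : pairwise ltn s -> uniq s.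
Proof.
rewrite -(sorted_pairwise ltn_trans) => ps.
exact: (sorted_uniq ltn_trans ltnn).
Qed.

Lemma pairwise_ltn_eq r s : pairwise ltn r -> pairwise ltn s -> r =i s -> r = s.
Proof.
rewrite -!(sorted_pairwise ltn_trans) => pr ps.
exact: (irr_sorted_eq ltn_trans ltnn).
Qed.

(** Makes a second row recoverable from its length and its positive entries. *)
Lemma zero_strict_split s : pairwise zero_strict s ->
  s = nseq (size s - size (filter (leq 1) s)) 0 ++ filter (leq 1) s.
Proof.
elim: s => //= x s IH /andP[xs ps].
have := size_filter (leq 1) s; have := count_size (leq 1) s.
case: x xs => [|x] xs /=.
  by move=> h1 h2; rewrite subSn ?h2 //= -h2 -IH.
move=> _ _; rewrite subSS.
have aps : all (leq 1) s.
  by apply/allP => y ys; have /andP[] := allP xs y ys; case: y {ys}.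
by move/all_filterP: aps => ->; rewrite subnn.
Qed.

Lemma all2_leq_all n r s : all2 leq s r -> all (gtn n) r -> all (gtn n) s.
Proof.
elim: s r => [|y s IH] [|x r] //= /andP[yx sr] /andP[xn rn].
by rewrite (leq_ltn_trans yx xn) (IH r).
Qed.

Lemma all2_leq_count r s x : all2 leq s r -> count (leq x) s <= count (leq x) r.
Proof.
elim: s r => [|y s IH] [|z r] //= /andP[yz /IH]; lia.
Qed.

Lemma count_leq_pos x s : 0 < x -> count (leq x) (filter (leq 1) s) = count (leq x) s.
Proof.
by move=> x0; rewrite count_filter; apply: eq_count => y /=; lia.
Qed.

Lemma all_filter_sub (T : Type) (a p : pred T) s : all a s -> all a (filter p s).
Proof. by elim: s => //= x s IH /andP[ax /IH]; case: ifP => //= _ ->; rewrite ax. Qed.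

Lemma index_rowsP n r s : index_rows n r s ->
  [/\ uniq r, uniq (filter (leq 1) s), all (gtn n) r & all (gtn n) (filter (leq 1) s)].
Proof.
case/and5P=> _ pr rn ps sr; split=> //; first exact: pairwise_ltn_uniq.
  by apply: pairwise_ltn_uniq; apply: zero_strict_pos.
exact/all_filter_sub/(all2_leq_all sr).
Qed.

(** Even positions below 2n only ask for values at least 1, so the word does not see the zeros of
    the second row. *)
Lemma bit_pos n r s p : p < n.*2 -> bit n r s p = bit n r (filter (leq 1) s) p.
Proof.
move=> pn; rewrite /bit mem_filter; case: ifP => // po.
have -> // : 1 <= n - p./2 by have := odd_double_half p; lia.
Qed.

Lemma eq_mkseq_bit n r s : mkseq (bit n r s) n.*2 = mkseq (bit n r (filter (leq 1) s)) n.*2.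
Proof. by apply/eq_in_map => p; rewrite mem_iota add0n => /bit_pos. Qed.

Lemma index_rows_ballot n r s : index_rows n r s ->
  ballot 0 (mkseq (bit n r s) n.*2).
Proof.
move=> irs; have [ur us rn sn] := index_rowsP irs; have [_ _ _ _ sr] := and5P irs.
rewrite eq_mkseq_bit; apply/(ballot_bits ur us rn sn) => x /andP[x0 _].
by rewrite count_leq_pos //; apply: all2_leq_count.
Qed.

Lemma index_rows_count n r s : index_rows n r s ->
  count negb (mkseq (bit n r s) n.*2) = n - count (pred1 0) s.
Proof.
move=> irs; have [ur us rn sn] := index_rowsP irs; have [/eqP rs _ _ _ _] := and5P irs.
rewrite eq_mkseq_bit; set t := filter _ s in us sn *.
have -> : count negb (mkseq (bit n r t) n.*2) =
    count (fun p => ~~ bit n r t p) (iota 0 n.*2) by rewrite count_map.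
(* For the full word, equal row lengths leave just the number of zeros as the deficit. *)
have := count_bits ur us rn sn (leqnn n); rewrite subnn /t count_leq_pos //.
have -> : count (leq 0) r = size r by apply/eqP; rewrite -all_count; apply/allP.
rewrite rs; have := count_predC (leq 1) s.
rewrite [count (predC _) s](_ : _ = count (pred1 0) s); last by apply: eq_count => -[].
by rewrite /=; lia.
Qed.

Lemma row1_pos n x : x < n -> (n - x.+1).*2.+1 < n.*2.
Proof. by move=> xn; lia. Qed.

Lemma row2_pos n x : 0 < x <= n -> (n - x).*2 < n.*2.
Proof. by move=> xn; lia. Qed.

Lemma bit_row1 n r s x : x < n -> bit n r s (n - x.+1).*2.+1 = (x \in r).
Proof.
move=> xn; rewrite /bit /= odd_double uphalf_double /=.
by have -> : n - (n - x.+1).+1 = x by lia.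
Qed.

Lemma bit_row2 n r s x : x <= n -> bit n r s (n - x).*2 = (x \notin s).
Proof. by move=> xn; rewrite /bit odd_double doubleK subKn. Qed.

Lemma gtn_notin n r x : all (gtn n) r -> n <= x -> x \in r = false.
Proof. by move=> rn nx; apply/negP => /(allP rn) /=; rewrite ltnNge nx. Qed.

(** The word gives the first row and the positive entries of the second; equality of lengths fixes
    the number of zeros. *)
Lemma index_rows_inj n r s r' s' : index_rows n r s -> index_rows n r' s' ->
  mkseq (bit n r s) n.*2 = mkseq (bit n r' s') n.*2 -> r = r' /\ s = s'.
Proof.
move=> irs irs' e.
have [_ _ rn sn] := index_rowsP irs; have [/eqP zs pr _ ps _] := and5P irs.
have [_ _ rn' sn'] := index_rowsP irs'; have [/eqP zs' pr' _ ps' _] := and5P irs'.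
have be p : p < n.*2 -> bit n r s p = bit n r' s' p.
  by move=> pn; have := congr1 (nth true ^~ p) e; rewrite !nth_mkseq.
have rr : r = r'.
  apply: pairwise_ltn_eq => // x; have [xn|xn] := ltnP x n.
    by rewrite -(bit_row1 r s xn) -(bit_row1 r' s' xn) be ?row1_pos.
  by rewrite (gtn_notin rn) ?(gtn_notin rn').
have ss : filter (leq 1) s = filter (leq 1) s'.
  apply: pairwise_ltn_eq; try exact: zero_strict_pos.
  move=> x; have [xn|xn] := ltnP x n.
    rewrite !mem_filter; case: (posnP x) => x0 //=; apply: negb_inj.
    rewrite -(bit_row2 r s (ltnW xn)) -(bit_row2 r' s' (ltnW xn)) be //.
    by apply: row2_pos; rewrite x0 ltnW.
  by rewrite (gtn_notin sn) ?(gtn_notin sn').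
split=> //; rewrite (zero_strict_split ps) (zero_strict_split ps') ss.
by rewrite -zs -zs' rr.
Qed.

Lemma count_leq_all y s : all (leq y) s -> count (leq y) s = size s.
Proof. by rewrite all_count => /eqP. Qed.

(** If the head [y] of [s] exceeded the head [x] of [r], the threshold [y] would count all of [s]
    but miss [x]. For the tails, thresholds up to [x] count all of [r], and larger ones count
    neither head. *)
Lemma count_all2_leq r s : pairwise ltn r -> pairwise leq s -> size r = size s ->
  (forall x, 0 < x -> count (leq x) s <= count (leq x) r) -> all2 leq s r.
Proof.
elim: s r => [|y s IH] [|x r] //= /andP[xr pr] /andP[ys ps] [rs] H.
have yx : y <= x.
  rewrite leqNgt; apply/negP => xy; have := H y (leq_trans (ltn0Sn x) xy).
  rewrite leqnn (count_leq_all ys) (ltn_geF xy) -rs.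
  by have := count_size (leq y) r; lia.
rewrite yx; apply: IH => // z z0; have := H z z0.
have [zx|xz] := leqP z x.
  rewrite [count (leq z) r]count_leq_all.
    by rewrite rs count_size.
  by apply/allP => t /(allP xr) /=; lia.
by rewrite (leqNgt z y) (leq_ltn_trans yx xz).
Qed.

Lemma index_rows_surj n w : 0 < n -> size w = n.*2 -> ballot 0 w ->
  exists r s, index_rows n r s /\ mkseq (bit n r s) n.*2 = w.
Proof.
move=> n0 sw bw.
pose r := [seq x <- iota 0 n | nth true w (n - x.+1).*2.+1].
pose b := [seq x <- iota 1 n.-1 | ~~ nth true w (n - x).*2].
have pr : pairwise ltn r.
  rewrite -(sorted_pairwise ltn_trans).
  exact: sorted_filter ltn_trans _ _ (iota_ltn_sorted _ _).
have pb : pairwise ltn b.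
  rewrite -(sorted_pairwise ltn_trans).
  exact: sorted_filter ltn_trans _ _ (iota_ltn_sorted _ _).
have rn : all (gtn n) r.
  by apply/allP => x; rewrite mem_filter mem_iota /= => /andP[_]; lia.
have bn : all (gtn n) b.
  by apply/allP => x; rewrite mem_filter mem_iota /= => /andP[_]; lia.
have b0 : all (leq 1) b.
  by apply/allP => x; rewrite mem_filter mem_iota /= => /andP[_]; lia.
have ur := pairwise_ltn_uniq pr; have ub := pairwise_ltn_uniq pb.
have wE : mkseq (bit n r b) n.*2 = w.
  apply: (@eq_from_nth _ true); rewrite size_mkseq // => p pn.
  rewrite nth_mkseq //.
  have := odd_double_half p; move: (odd p) (p./2) => c j pE.
  case: c pE => pE.
    have jn : n - j.+1 < n by lia.
    have jE : (n - (n - j.+1).+1) = j by lia.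
    have := bit_row1 r b jn; rewrite jE (_ : j.*2.+1 = p); last by lia.
    move=> ->; rewrite mem_filter mem_iota jE add0n jn /= andbT.
    by congr nth; lia.
  have jn : j <= n by lia.
  have jE : n - (n - j) = j by apply: subKn.
  have := bit_row2 r b (leq_subr j n); rewrite jE (_ : j.*2 = p); last by lia.
  move=> ->; rewrite mem_filter mem_iota jE (_ : j.*2 = p); last by lia.
  (* The first letter asks whether [n] is missing from the second row; it always is, matching the
     opening letter that starts a ballot word. *)
  have [j0|j0] := posnP j.
    have -> : p = 0 by lia.
    by case: (w) bw {sw} => [|[] w'] //=; lia.
  by rewrite (_ : _ && (_ < _)) ?andbT ?negbK //; lia.
have H : forall x, 0 < x -> count (leq x) b <= count (leq x) r.
  move=> x x0; have [xn|xn] := leqP x n.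
    by apply: (ballot_bits ur ub rn bn) => //; rewrite ?wE // x0.
  rewrite [count _ b](_ : _ = 0) //; apply/eqP; rewrite -leqn0 leqNgt -has_count.
  by apply/hasPn => y /(allP bn) /=; lia.
have br : size b <= size r.
  by have := H 1 isT; rewrite count_leq_all //; have := count_size (leq 1) r; lia.
(* Zeros pad the second row to the length of the first; the inequality at threshold 1 leaves room
   for them. *)
pose s := nseq (size r - size b) 0 ++ b.
have sE : filter (leq 1) s = b.
  by rewrite filter_cat filter_nseq /= (all_filterP b0).
exists r, s; split; last by rewrite eq_mkseq_bit sE.
have zs : size r = size s by rewrite size_cat size_nseq subnK.
have ps : pairwise zero_strict s.
  rewrite pairwise_cat; apply/and3P; split.
  - by apply/allrelP => x y; rewrite mem_nseq => /andP[_ /eqP->]; case: y.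
  - by apply/(pairwiseP 0) => i j; rewrite !inE !size_nseq !nth_nseq => -> ->.
  - by apply: sub_pairwise pb => x y xy; rewrite /zero_strict ltnW //= ltn_eqF.
rewrite /index_rows zs eqxx pr rn ps /=; apply: count_all2_leq => //.
  by apply: sub_pairwise ps => x y /andP[].
by move=> x x0; rewrite -(count_leq_pos s x0) sE; apply: H.
Qed.

(** * Matrices as pairs of rows *)

Definition entries n (i : 'I_2) (a : index_candidate n) : seq nat :=
  if a is Some A then [seq val (tagged A i j) | j <- enum 'I_(tag A).+1]
  else [::].

Lemma all_enum (T : finType) (P : pred T) : all P (enum T) = [forall x, P x].
Proof.
by apply/allP/forallP => H x; [apply: H; rewrite mem_enum|move=> _; apply: H].
Qed.

Lemma pairwise_enum m (T : Type) (e : rel T) (f : 'I_m -> T) :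
  pairwise e [seq f j | j <- enum 'I_m] =
  [forall j : 'I_m, forall k : 'I_m, (j < k) ==> e (f j) (f k)].
Proof.
rewrite pairwise_map; case: m f => [|m] f.
  rewrite (size0nil (size_enum_ord 0)) /=; apply/esym/forallP => -[] //.
apply/(pairwiseP ord0)/forallP => H.
  move=> j; apply/forallP => k; apply/implyP => jk.
  by have := H j k; rewrite !inE !size_enum_ord !nth_ord_enum /=; apply.
move=> i j; rewrite !inE !size_enum_ord => im jm ij.
have /forallP/(_ (Ordinal jm))/implyP := H (Ordinal im).
by rewrite -[i]/(val (Ordinal im)) -[j]/(val (Ordinal jm)) !nth_ord_enum; apply.
Qed.

Lemma all2_map (T U : Type) (e : rel U) (f g : T -> U) s :
  all2 e (map f s) (map g s) = all (fun x => e (f x) (g x)) s.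
Proof. by elim: s => //= x s ->. Qed.

Lemma indexing_matrixE n (a : index_candidate n) :
  indexing_matrix a = index_rows n (entries ord0 a) (entries ord_max a).
Proof.
case: a => [[m A]|] //; rewrite /index_rows /= /is_indexing !size_map eqxx /=.
rewrite !pairwise_enum all2_map all_map !all_enum.
have -> /= : [forall x, preim (fun j => val (A ord0 j)) (gtn n) x].
  by apply/forallP => j /=.
congr (_ && _); rewrite andbA; congr (_ && _).
apply/andP/forallP => [[/forallP H1 /forallP H2] j|H].
  apply/forallP => k; apply/implyP => jk; rewrite /zero_strict.
  have /forallP/(_ k)/implyP/(_ jk) -> /= := H1 j.
  have /forallP/(_ k) := H2 j; rewrite jk /= -val_eqE /=.
  case: eqP => //= e /eqP f; apply/eqP; lia.
split; apply/forallP => j; apply/forallP => k; apply/implyP.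
  by move=> jk; have /forallP/(_ k)/implyP/(_ jk)/andP[] := H j.
case/andP=> jk /eqP e; have /forallP/(_ k)/implyP/(_ jk)/andP[_] := H j.
by rewrite e eqxx.
Qed.

Lemma count_enum (T : finType) (P : pred T) : count P (enum T) = #|P|.
Proof. by rewrite cardE -size_filter enumT. Qed.

Lemma blob_rankE n (a : index_candidate n) : indexing_matrix a ->
  blob_rank a = count (pred1 0) (entries ord_max a).
Proof.
case: a => [[m A]|] //= /and4P[_ _ _ /forallP H].
rewrite count_map count_enum; apply: eq_card => j; rewrite !inE.
apply/existsP/idP => [[i /eqP Aij]|]; last by exists ord_max.
have := H j; have [e|e] : i = ord0 \/ i = ord_max.
- by case: i {Aij} => [[|[|]]] // ?; [left|right]; apply: val_inj.
- by subst i; rewrite Aij leqn0.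
- by subst i; rewrite Aij.
Qed.

Lemma size_entries n (i : 'I_2) (A : {m : 'I_n & 'M['I_n]_(2, m.+1)}) :
  size (entries i (Some A)) = (tag A).+1.
Proof. by rewrite size_map size_enum_ord. Qed.

Lemma nth_entries n (i : 'I_2) (A : {m : 'I_n & 'M['I_n]_(2, m.+1)})
    (j : 'I_(tag A).+1) :
  nth 0 (entries i (Some A)) j = tagged A i j.
Proof. by rewrite (nth_map ord0) ?size_enum_ord // nth_ord_enum. Qed.

Lemma entries_inj n (a b : index_candidate n) :
  entries ord0 a = entries ord0 b -> entries ord_max a = entries ord_max b ->
  a = b.
Proof.
case: a b => [A|] [B|] // e1; have := congr1 size e1; rewrite ?size_entries //.
case: A B e1 => [m A] [m' B] e1 [/val_inj mm] e2; rewrite /= in mm; subst m'.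
congr (Some (existT _ _ _)); apply/matrixP => i j; apply: val_inj.
have [->|->] : i = ord0 \/ i = ord_max.
  by case: i => [[|[|]]] // ?; [left|right]; apply: val_inj.
- by have := congr1 (nth 0 ^~ j) e1; rewrite !nth_entries.
- by have := congr1 (nth 0 ^~ j) e2; rewrite !nth_entries.
Qed.

Lemma entries_surj n r s : 0 < n -> index_rows n r s ->
  exists a : index_candidate n, entries ord0 a = r /\ entries ord_max a = s.
Proof.
move=> n0 irs; have [ur _ rn _] := index_rowsP irs.
have /and5P[/eqP rs _ _ _ sr] := irs; have sn := all2_leq_all sr rn.
have [r0|r0] := posnP (size r).
  exists None; move: rs; rewrite r0; case: r r0 {irs ur rn sr} => // _.
  by case: s {sn}.
(* The entries of the first row are distinct and below [n], so there are at most [n] columns. *)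
have rsize : (size r).-1 < n.
  rewrite prednK // -(size_iota 0 n); apply: uniq_leq_size => // x /(allP rn) /= xn.
  by rewrite mem_iota.
(* The default of [insubd] is never taken, as all entries are below [n]. *)
pose A : 'M['I_n]_(2, (Ordinal rsize).+1) :=
  (\matrix_(i, j) insubd (Ordinal n0) (nth 0%N (if i == ord0 then r else s) j))%R.
have AE (i : 'I_2) t : t = (if i == ord0 then r else s) -> size t = size r ->
    all (gtn n) t -> entries i (Some (existT _ (Ordinal rsize) A)) = t.
  move=> tE ts tn; have st : (size r).-1.+1 = size r by apply: prednK.
  apply: (@eq_from_nth _ 0); rewrite size_entries ?ts // => j jm.
  have jr : j < size r by rewrite -st.
  rewrite -[j]/(val (Ordinal jm)) nth_entries.
  by rewrite mxE -tE val_insubd ifT //=; apply: (allP tn); rewrite mem_nth // ts.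
by exists (Some (existT _ (Ordinal rsize) A)); split; apply: AE.
Qed.

Definition index_word n (a : index_candidate n) : (n.*2).-tuple bool :=
  [tuple bit n (entries ord0 a) (entries ord_max a) p | p < n.*2].

Lemma index_wordE n (a : index_candidate n) :
  index_word a = mkseq (bit n (entries ord0 a) (entries ord_max a)) n.*2 :> seq bool.
Proof. by rewrite /mkseq -val_enum_ord -map_comp. Qed.

Lemma sum_indexing (T : nmodType) n (F : nat -> T) : 0 < n ->
  (\sum_(a : index_candidate n | indexing_matrix a) F (n - blob_rank a)%N =
   \sum_(w : (n.*2).-tuple bool | ballot 0 w) F (count negb w))%R.
Proof.
move=> n0; pose W := [set w : (n.*2).-tuple bool | ballot 0 w].
pose I := [set a : index_candidate n | indexing_matrix a].
have WE : W = (@index_word n) @: I.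
  apply/setP => w; rewrite inE; apply/idP/imsetP => [bw|[a]].
    have [r [s [irs wE]]] := index_rows_surj n0 (size_tuple w) bw.
    have [a [ar as_]] := entries_surj n0 irs; exists a.
      by rewrite inE indexing_matrixE ar as_.
    by apply: val_inj; rewrite /= index_wordE ar as_.
  by rewrite inE indexing_matrixE => ia ->; rewrite index_wordE; apply: index_rows_ballot.
have -> : (\sum_(w : (n.*2).-tuple bool | ballot 0 w) F (count negb w) =
    \sum_(w in W) F (count negb w))%R by apply: eq_bigl => w; rewrite inE.
rewrite WE big_imset /=.
  apply: eq_big => [a|a ia]; first by rewrite inE.
  rewrite blob_rankE // index_wordE index_rows_count //.
  by rewrite -indexing_matrixE.
move=> a b; rewrite !inE !indexing_matrixE => ia ib /(congr1 val).
rewrite /= !index_wordE => /(index_rows_inj ia ib)[]; exact: entries_inj.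
Qed.

(** * Counting the abacus hook monoid *)

Lemma card_beads d : 0 < d -> #|beads d| = d.
Proof. by move=> d0; rewrite card_ord prednK. Qed.

Lemma card_abacus_hook d n : 0 < d ->
  #|abacus_hook d n| = \sum_(P in hook_blob n) d ^ #|val P|.
Proof.
move=> d0; rewrite card_tagged sumnE big_map big_enum /=.
rewrite (reindex_omap (val : hook_diagram n -> _) insub) => [|P HP]; last first.
  by rewrite insubT.
apply: eq_big => [P|P _]; first by rewrite valK eqxx andbT; apply/esym/(valP P).
by rewrite card_ffun card_beads // card_sig.
Qed.

Lemma blob_rank_le n (a : index_candidate n) : blob_rank a <= n.
Proof.
case: a => [[m A]|] //=; apply: leq_trans (max_card _) _.
by rewrite card_ord; apply: ltn_ord.
Qed.

Local Open Scope ring_scope.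

Theorem theorem6p17 (d n : nat) (d_gt0 : (0 < d)%N) (n_gt0 : (0 < n)%N) :
  (#|abacus_hook d n|%:R : rat) =
  d%:R ^+ n.+1 * \sum_(0 <= k < n.+1) (Omega n k)%:R * d%:R ^- k.
Proof.
rewrite card_abacus_hook // natr_sum.
rewrite (sum_hook_blob (fun k => (d ^ k)%:R) n_gt0).
(* The number of blocks, one more than the number of closing letters, becomes
   [(n - blob_rank a).+1]. *)
rewrite -(sum_indexing (fun k => (d ^ k.+1)%:R) n_gt0).
have d0 : d%:R != 0 :> rat by rewrite pnatr_eq0 -lt0n.
rewrite big_mkord mulr_sumr.
(* Group the matrices by blob-rank; [inord] loses nothing because the rank is at most [n]. *)
rewrite (partition_big (fun a => inord (blob_rank a) : 'I_n.+1) predT) //=.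
apply: eq_bigr => k _; rewrite /Omega -sum1_card natr_sum mulr_suml mulr_sumr.
apply: eq_big => [a|a /andP[_ /eqP <-]].
  by rewrite !inE -val_eqE /= inordK // ltnS blob_rank_le.
have le := blob_rank_le a.
rewrite inordK ?ltnS // mul1r natrX -subSn // expfB_cond ?(negbTE d0) //=.
by rewrite add0n leqW.
Qed.
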